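(* Let $\kappa$ be an infinite regular cardinal, and let $\mathsf{Set}_{\bar\Delta}^{<\kappa}$ denote the full subcategory of $\mathsf{Set}_{\bar\Delta}$ consisting of the sets of cardinality less than $\kappa$. Then $\mathsf{Set}_{\bar\Delta}^{<\kappa}$ is the initial $\kappa$-distributive, externally iterable, coinflip Markov category: it is itself such a Markov category, and for every $\kappa$-distributive, externally iterable, coinflip Markov category $\mathcal{C}$ there is a Markov functor $\mathsf{Set}_{\bar\Delta}^{<\kappa}\to\mathcal{C}$ preserving $\kappa$-small coproducts, unique up to unique monoidal natural isomorphism. In particular, $\mathsf{FinStoch}$ is the initial (finitely) distributive, externally iterable, coinflip Markov category, and $\mathsf{Set}_{\bar\Delta}$ is the initial small-distributive, externally iterable, coinflip Markov category (in the same sense, with respect to Markov functors preserving finite, respectively small, coproducts).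
   Context: $\bar\Delta$ is the monad on $\mathsf{Set}$ of countably supported probability distributions, $\bar\Delta(X)=\{(a_x)_{x\in X}\mid a_x\ge 0,\ \sum_x a_x=1\}$; $\mathsf{Set}_{\bar\Delta}$ is its Kleisli category, a Markov category with copy maps the diagonals. $\mathsf{FinStoch}$ is the Markov category of finite sets and stochastic matrices. **Markov categories.** A Markov category is a symmetric monoidal category $(\mathcal{C},\otimes,I)$ in which every object $X$ is equipped with a commutative comonoid structure $(\mathrm{copy}_X: X\to X\otimes X,\ \mathrm{del}_X : X\to I)$ with $\mathrm{del}_{X\otimes Y}=\mathrm{del}_X\otimes \mathrm{del}_Y$ and $\mathrm{copy}_{X\otimes Y}=(X\otimes \sigma_{X,Y}\otimes Y)(\mathrm{copy}_X\otimes \mathrm{copy}_Y)$ ($\sigma$ the symmetry), and with $\mathrm{del}$ natural. Structural isomorphisms are suppressed. A morphism $f:X\to Y$ is deterministic if $\mathrm{copy}_Y f=(f\otimes f)\mathrm{copy}_X$; the deterministic morphisms form a Cartesian monoidal subcategory $\mathcal{C}_{\mathrm{det}}$. A Markov functor is a strong symmetric monoidal functor $F$ such that $F(X)\xrightarrow{F(\mathrm{copy}_X)}F(X\otimes X)\cong F(X)\otimes F(X)$ equals $\mathrm{copy}_{F(X)}$. **Distributive.** A Markov category $\mathcal{C}$ is $\kappa$-distributive if $\mathcal{C}_{\mathrm{det}}$ admits $\kappa$-small coproducts and these are preserved by the inclusion $\mathcal{C}_{\mathrm{det}}\hookrightarrow\mathcal{C}$ and by the tensors $A\otimes -$. ''Distributive''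 is the case of finite coproducts ($\kappa=\omega$); ''small-distributive'' is the case of all small coproducts. **Coinflip, iterable.** A midpoint algebra (in sets) is a set $A$ with $m:A\times A\to A$ satisfying $m(a,a)=a$, $m(a,b)=m(b,a)$, $m(m(a,b),m(c,d))=m(m(a,c),m(b,d))$; a midpoint homomorphism is a map commuting with $m$. It is iterable if for every set $X$ and every $s:X\to X\times A$ there is a unique $u:X\to A$ with $u=m\circ(u\times A)\circ s$. A coinflip structure on a Markov category $\mathcal{C}$ is a midpoint algebra structure on each hom-set $\mathcal{C}(X,Y)$ such that all pre- and postcomposition maps are midpoint homomorphisms; it is unique if it exists. A coinflip Markov category is a Markov category admitting a coinflip structure; it is externally iterable if all the midpoint algebras $\mathcal{C}(X,Y)$ are iterable. *)

(* Defs.v *)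
From mathcomp Require Import all_boot all_order all_algebra.
From mathcomp Require Import boolp classical_sets functions cardinality.
From mathcomp Require Import reals ereal esum.

Set Implicit Arguments.
Unset Strict Implicit.
Unset Printing Implicit Defensive.

(* The universe of sets: the objects of [SetDelta] and the index sets of
   coproducts live there, while the hom-types and the type of objects of a
   [category] may be larger. *)
Definition smallset := Type.

Reserved Notation "g ∘ f" (at level 40, left associativity).
Reserved Notation "X ⊗ Y" (at level 34, right associativity).
Reserved Notation "f ⊠ g" (at level 34, right associativity).

Record category := Category {
  ob :> Type;
  hom : ob -> ob -> Type;
  idm : forall X, hom X X;
  comp : forall X Y Z, hom Y Z -> hom X Y -> hom X Z
    where "g ∘ f" := (comp g f);
  comp1m : forall X Y (f : hom X Y), idm Y ∘ f = f;
  compm1 : forall X Y (f : hom X Y), f ∘ idm X = f;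
  compA : forall X Y Z W (h : hom Z W) (g : hom Y Z) (f : hom X Y),
    h ∘ (g ∘ f) = (h ∘ g) ∘ f
}.

Arguments hom {c} X Y.
Arguments idm {c} X.
Arguments comp {c X Y Z} g f.
Notation "g ∘ f" := (comp g f).

Definition is_iso (C : category) (X Y : C) (f : hom X Y) : Prop :=
  exists g : hom Y X, g ∘ f = idm X /\ f ∘ g = idm Y.

Record functor (C D : category) := Functor {
  fob :> C -> D;
  fmap : forall X Y : C, hom X Y -> hom (fob X) (fob Y);
  fmap1 : forall X : C, fmap (idm X) = idm (fob X);
  fmap_comp : forall (X Y Z : C) (g : hom Y Z) (f : hom X Y),
    fmap (g ∘ f) = fmap g ∘ fmap f
}.

Record symmon := SymMon {
  smcat :> category;
  unitob : smcat;
  tensob : smcat -> smcat -> smcat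
    where "X ⊗ Y" := (tensob X Y);
  tens : forall X X' Y Y' : smcat,
    hom X X' -> hom Y Y' -> hom (X ⊗ Y) (X' ⊗ Y')
    where "f ⊠ g" := (tens f g);
  assoc : forall X Y Z : smcat, hom ((X ⊗ Y) ⊗ Z) (X ⊗ (Y ⊗ Z));
  associ : forall X Y Z : smcat, hom (X ⊗ (Y ⊗ Z)) ((X ⊗ Y) ⊗ Z);
  lunit : forall X : smcat, hom (unitob ⊗ X) X;
  luniti : forall X : smcat, hom X (unitob ⊗ X);
  runit : forall X : smcat, hom (X ⊗ unitob) X;
  runiti : forall X : smcat, hom X (X ⊗ unitob);
  swap : forall X Y : smcat, hom (X ⊗ Y) (Y ⊗ X);
  tens1 : forall X Y : smcat, idm X ⊠ idm Y = idm (X ⊗ Y);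
  tens_comp : forall (X X' X'' Y Y' Y'' : smcat) (f' : hom X' X'')
      (f : hom X X') (g' : hom Y' Y'') (g : hom Y Y'),
    (f' ∘ f) ⊠ (g' ∘ g) = (f' ⊠ g') ∘ (f ⊠ g);
  assocK : forall X Y Z, associ X Y Z ∘ assoc X Y Z = idm _;
  associK : forall X Y Z, assoc X Y Z ∘ associ X Y Z = idm _;
  lunitK : forall X, luniti X ∘ lunit X = idm _;
  lunitiK : forall X, lunit X ∘ luniti X = idm _;
  runitK : forall X, runiti X ∘ runit X = idm _;
  runitiK : forall X, runit X ∘ runiti X = idm _;
  swapK : forall X Y, swap Y X ∘ swap X Y = idm _;
  assoc_nat : forall (X X' Y Y' Z Z' : smcat)
      (f : hom X X') (g : hom Y Y') (h : hom Z Z'),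
    assoc X' Y' Z' ∘ ((f ⊠ g) ⊠ h) = (f ⊠ (g ⊠ h)) ∘ assoc X Y Z;
  lunit_nat : forall (X X' : smcat) (f : hom X X'),
    lunit X' ∘ (idm unitob ⊠ f) = f ∘ lunit X;
  runit_nat : forall (X X' : smcat) (f : hom X X'),
    runit X' ∘ (f ⊠ idm unitob) = f ∘ runit X;
  swap_nat : forall (X X' Y Y' : smcat) (f : hom X X') (g : hom Y Y'),
    swap X' Y' ∘ (f ⊠ g) = (g ⊠ f) ∘ swap X Y;
  pentagon : forall X Y Z W : smcat,
    assoc X Y (Z ⊗ W) ∘ assoc (X ⊗ Y) Z W
    = (idm X ⊠ assoc Y Z W) ∘ assoc X (Y ⊗ Z) W ∘ (assoc X Y Z ⊠ idm W);
  triangle : forall X Y : smcat,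
    (idm X ⊠ lunit Y) ∘ assoc X unitob Y = runit X ⊠ idm Y;
  hexagon : forall X Y Z : smcat,
    assoc Y Z X ∘ swap X (Y ⊗ Z) ∘ assoc X Y Z
    = (idm Y ⊠ swap X Z) ∘ assoc Y X Z ∘ (swap X Y ⊠ idm Z)
}.

Arguments unitob {s}.
Arguments tensob {s} X Y.
Arguments tens {s X X' Y Y'} f g.
Arguments assoc {s} X Y Z.
Arguments associ {s} X Y Z.
Arguments lunit {s} X.
Arguments luniti {s} X.
Arguments runit {s} X.
Arguments runiti {s} X.
Arguments swap {s} X Y.
Notation "X ⊗ Y" := (tensob X Y).
Notation "f ⊠ g" := (tens f g).

(* (X ⊗ X') ⊗ (Y ⊗ Y') -> (X ⊗ Y) ⊗ (X' ⊗ Y'), that is X ⊗ σ ⊗ Y' up to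
   the structural isomorphisms *)
Definition interchange (C : symmon) (X X' Y Y' : C) :
    hom ((X ⊗ X') ⊗ (Y ⊗ Y')) ((X ⊗ Y) ⊗ (X' ⊗ Y')) :=
  associ X Y (X' ⊗ Y')
  ∘ (idm X ⊠ (assoc Y X' Y' ∘ (swap X' Y ⊠ idm Y') ∘ associ X' Y Y'))
  ∘ assoc X X' (Y ⊗ Y').
Arguments interchange {C} X X' Y Y'.

Record markov := Markov {
  msymmon :> symmon;
  copy : forall X : msymmon, hom X (X ⊗ X);
  del : forall X : msymmon, hom X unitob;
  copyA : forall X,
    assoc X X X ∘ (copy X ⊠ idm X) ∘ copy X = (idm X ⊠ copy X) ∘ copy X;
  copy1 : forall X, lunit X ∘ (del X ⊠ idm X) ∘ copy X = idm X;
  copyC : forall X, swap X X ∘ copy X = copy X;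
  copy_tens : forall X Y,
    copy (X ⊗ Y) = interchange X X Y Y ∘ (copy X ⊠ copy Y);
  del_tens : forall X Y, del (X ⊗ Y) = lunit unitob ∘ (del X ⊠ del Y);
  del_nat : forall (X Y : msymmon) (f : hom X Y), del Y ∘ f = del X
}.

Arguments copy {m} X.
Arguments del {m} X.

Definition deterministic (C : markov) (X Y : C) (f : hom X Y) : Prop :=
  copy Y ∘ f = (f ⊠ f) ∘ copy X.

Section Deterministic.
Variable C : markov.
Implicit Types X Y Z : C.

Lemma det_ext X Y (f g : {f : hom X Y | deterministic f}) :
  sval f = sval g -> f = g.
Proof.
by case: f g => f hf [g hg] /= fg; subst g; congr exist; exact: Prop_irrelevance.
Qed.

Lemma det_id X : deterministic (idm X).
Proof. by rewrite /deterministic compm1 tens1 comp1m. Qed.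

Lemma det_comp X Y Z (g : hom Y Z) (f : hom X Y) :
  deterministic g -> deterministic f -> deterministic (g ∘ f).
Proof.
rewrite /deterministic => dg df.
by rewrite compA dg -compA df compA tens_comp.
Qed.

Lemma associ_nat (X X' Y Y' Z Z' : C)
    (f : hom X X') (g : hom Y Y') (h : hom Z Z') :
  associ X' Y' Z' ∘ (f ⊠ (g ⊠ h)) = ((f ⊠ g) ⊠ h) ∘ associ X Y Z.
Proof.
rewrite -[LHS]compm1 -[in LHS]associK compA -[in LHS](compA (associ _ _ _)).
by rewrite -assoc_nat compA assocK comp1m.
Qed.

Lemma interchange_nat (X X' Y Y' Z Z' W W' : C) (f : hom X X')
    (g : hom Y Y') (h : hom Z Z') (k : hom W W') :
  interchange X' Y' Z' W' ∘ ((f ⊠ g) ⊠ (h ⊠ k))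
  = ((f ⊠ h) ⊠ (g ⊠ k)) ∘ interchange X Y Z W.
Proof.
rewrite /interchange -compA assoc_nat !compA -[in RHS]associ_nat.
congr (_ ∘ _); rewrite -[LHS]compA -[RHS]compA; congr (_ ∘ _).
rewrite -!tens_comp comp1m compm1; congr (_ ⊠ _).
rewrite -compA associ_nat !compA -[in RHS]assoc_nat; congr (_ ∘ _).
rewrite -[LHS]compA -[RHS]compA; congr (_ ∘ _).
by rewrite -!tens_comp swap_nat comp1m compm1.
Qed.

Lemma det_tens (A X Y : C) (f : hom X Y) :
  deterministic f -> deterministic (idm A ⊠ f).
Proof.
rewrite /deterministic => df.
rewrite !copy_tens -compA -tens_comp df compm1 compA -interchange_nat -compA.
by rewrite -tens_comp tens1 comp1m.
Qed.

Definition detcat : category.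
Proof.
refine (@Category C (fun X Y => {f : hom X Y | deterministic f})
  (fun X => exist _ (idm X) (det_id X))
  (fun X Y Z g f => exist _ (sval g ∘ sval f)
                      (det_comp (proj2_sig g) (proj2_sig f))) _ _ _).
- by move=> X Y f; apply: det_ext; rewrite /= comp1m.
- by move=> X Y f; apply: det_ext; rewrite /= compm1.
- by move=> X Y Z W h g f; apply: det_ext; rewrite /= compA.
Defined.

Definition det_incl : functor detcat C.
Proof.
by refine (@Functor detcat C (fun X => X) (fun X Y f => sval f) _ _).
Defined.

Definition det_tensor (A : C) : functor detcat detcat.
Proof.
refine (@Functor detcat detcat (fun X => A ⊗ (X : C))
  (fun X Y f => exist _ (idm A ⊠ sval f) (det_tens A (proj2_sig f))) _ _).
- by move=> X; apply: det_ext; rewrite /= tens1.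
- by move=> X Y Z g f; apply: det_ext; rewrite /= -tens_comp comp1m.
Defined.

End Deterministic.

Definition is_coproduct (C : category) (I : smallset) (X : I -> C) (S : C)
    (inj : forall i, hom (X i) S) : Prop :=
  forall (Y : C) (f : forall i, hom (X i) Y),
    exists! h : hom S Y, forall i, h ∘ inj i = f i.

(* [small] selects the index sets of the coproducts under consideration. *)
Definition has_coproducts (small : smallset -> Prop) (C : category) : Prop :=
  forall (I : smallset) (X : I -> C), small I ->
    exists (S : C) (inj : forall i, hom (X i) S), is_coproduct inj.

Definition preserves_coproducts (small : smallset -> Prop) (C D : category)
    (F : functor C D) : Prop :=
  forall (I : smallset) (X : I -> C) (S : C) (inj : forall i, hom (X i) S),
    small I -> is_coproduct inj ->
    is_coproduct (fun i => fmap F (inj i)).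

(* The coproducts are those of [detcat C]; since coproducts are unique up to
   isomorphism, preserving all coproduct cocones amounts to preserving chosen
   ones. *)
Definition distributive (small : smallset -> Prop) (C : markov) : Prop :=
  [/\ has_coproducts small (detcat C),
      preserves_coproducts small (det_incl C)
    & forall A : C, preserves_coproducts small (det_tensor A)].

Record symmon_functor (C D : symmon) := SymMonFunctor {
  smfunctor :> functor C D;
  mu : forall X Y : C,
    hom (smfunctor X ⊗ smfunctor Y) (smfunctor (X ⊗ Y));
  mui : forall X Y : C,
    hom (smfunctor (X ⊗ Y)) (smfunctor X ⊗ smfunctor Y);
  mu0 : hom unitob (smfunctor unitob);
  mu0i : hom (smfunctor unitob) unitob;
  muK : forall X Y, mui X Y ∘ mu X Y = idm _;
  muiK : forall X Y, mu X Y ∘ mui X Y = idm _;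
  mu0K : mu0i ∘ mu0 = idm _;
  mu0iK : mu0 ∘ mu0i = idm _;
  mu_nat : forall (X X' Y Y' : C) (f : hom X X') (g : hom Y Y'),
    mu X' Y' ∘ (fmap smfunctor f ⊠ fmap smfunctor g)
    = fmap smfunctor (f ⊠ g) ∘ mu X Y;
  mu_assoc : forall X Y Z : C,
    fmap smfunctor (assoc X Y Z) ∘ mu (X ⊗ Y) Z ∘ (mu X Y ⊠ idm _)
    = mu X (Y ⊗ Z) ∘ (idm _ ⊠ mu Y Z) ∘ assoc _ _ _;
  mu_lunit : forall X : C,
    fmap smfunctor (lunit X) ∘ mu unitob X ∘ (mu0 ⊠ idm _) = lunit _;
  mu_runit : forall X : C,
    fmap smfunctor (runit X) ∘ mu X unitob ∘ (idm _ ⊠ mu0) = runit _;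
  mu_swap : forall X Y : C,
    fmap smfunctor (swap X Y) ∘ mu X Y = mu Y X ∘ swap _ _
}.

Record markov_functor (C D : markov) := MarkovFunctor {
  msymmon_functor :> symmon_functor C D;
  (* F X -> F (X ⊗ X) ≅ F X ⊗ F X *)
  fmap_copy : forall X : C,
    mui msymmon_functor X X ∘ fmap msymmon_functor (copy X)
    = copy (msymmon_functor X)
}.

Definition monoidal_natiso (C D : symmon) (F G : symmon_functor C D)
    (theta : forall X : C, hom (F X) (G X)) : Prop :=
  [/\ forall (X Y : C) (f : hom X Y),
        theta Y ∘ fmap F f = fmap G f ∘ theta X,
      forall X : C, is_iso (theta X),
      forall X Y : C, theta (X ⊗ Y) ∘ mu F X Y = mu G X Y ∘ (theta X ⊠ theta Y)
    & theta unitob ∘ mu0 F = mu0 G].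

Record midpoint_algebra (A : Type) := MidpointAlgebra {
  mid :> A -> A -> A;
  mid_idem : forall a, mid a a = a;
  mid_comm : forall a b, mid a b = mid b a;
  mid_medial : forall a b c d,
    mid (mid a b) (mid c d) = mid (mid a c) (mid b d)
}.

Definition midpoint_hom (A B : Type) (m : midpoint_algebra A)
    (n : midpoint_algebra B) (f : A -> B) : Prop :=
  forall a b, f (m a b) = n (f a) (f b).

Definition iterable (A : Type) (m : midpoint_algebra A) : Prop :=
  forall (X : smallset) (s : X -> X * A),
    exists! u : X -> A, forall x, u x = m (u (s x).1) (s x).2.

Record coinflip (C : markov) := Coinflip {
  coin :> forall X Y : C, midpoint_algebra (hom X Y);
  coin_post : forall (X Y Z : C) (g : hom Y Z),
    midpoint_hom (coin X Y) (coin X Z) (fun f => g ∘ f);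
  coin_pre : forall (X Y Z : C) (f : hom X Y),
    midpoint_hom (coin Y Z) (coin X Z) (fun g => g ∘ f)
}.

Definition externally_iterable (C : markov) (c : coinflip C) : Prop :=
  forall X Y : C, iterable (c X Y).

Definition dist_iter_coinflip (small : smallset -> Prop) (C : markov) : Prop :=
  distributive small C /\ exists c : coinflip C, externally_iterable c.

Definition initial_dist_iter_coinflip (small : smallset -> Prop) (C : markov)
    : Prop :=
  dist_iter_coinflip small C /\
  forall D : markov, dist_iter_coinflip small D ->
    (exists F : markov_functor C D, preserves_coproducts small F) /\
    (forall F G : markov_functor C D,
       preserves_coproducts small F -> preserves_coproducts small G ->
       exists! theta : forall X : C, hom (F X) (G X),
         monoidal_natiso theta).

Local Open Scope classical_set_scope.
Local Open Scope card_scope.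

(* A cardinal is represented by a set [K] of that cardinality. *)
Definition card_lt (X K : smallset) : Prop :=
  [set: X] #<= [set: K] /\ [set: X] #!= [set: K].

(* Regularity: a disjoint union of fewer than K sets, each of cardinality less
   than K, has cardinality less than K. *)
Definition infinite_regular (K : smallset) : Prop :=
  infinite_set [set: K] /\
  forall (I : smallset) (X : I -> smallset), card_lt I K ->
    (forall i, card_lt (X i) K) -> card_lt {i : I & X i} K.

Definition small_lt (K : smallset) : smallset -> Prop := fun I => card_lt I K.
Definition small_finite : smallset -> Prop := fun I => finite_set [set: I].
Definition small_all : smallset -> Prop := fun=> True.

Lemma card_lt_prod (K X Y : smallset) : infinite_regular K ->
  card_lt X K -> card_lt Y K -> card_lt (X * Y)%type K.
Proof.
move=> [_ regK] XK YK; have := regK X (fun=> Y) XK (fun=> YK).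
suff XY : [set: (X * Y)%type] #= [set: {_ : X & Y}].
  rewrite /card_lt => -[le ne]; split; first by rewrite (card_le_eql XY).
  by rewrite (card_eql XY).
have : set_bij [set: (X * Y)%type] [set: {_ : X & Y}]
    (fun z => existT (fun=> Y) z.1 z.2).
  split=> //.
    by move=> [a b] [c d] _ _ /= e; 
    exact: (f_equal (fun z : {_ : X & Y} => (projT1 z, projT2 z : Y)) e).
  by move=> [x y] _; exists (x, y).
by move=> /Pbij[f _]; exact: pcard_eq f.
Qed.

Lemma card_lt_unit (K : smallset) : infinite_regular K -> card_lt unit K.
Proof.
move=> [infK _]; split; last first.
  apply/negP => e; apply: infK; have [n en] : finite_set [set: unit] by [].
  by exists n; rewrite -(card_eql e).
have [k _] : [set: K] !=set0 by exact: infinite_setN0.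
have : $|{injfun [set: unit] >-> [set: K]}|.
  by apply/injfunPex; exists (fun=> k) => // -[] [].
by move=> [f]; exact: inj_card_le f.
Qed.

Section FullMarkov.
Variables (C : markov) (P : C -> Prop).
Hypotheses (P1 : P unitob) (PM : forall X Y, P X -> P Y -> P (X ⊗ Y)).

Definition full_category : category :=
  @Category {X : C | P X} (fun X Y => hom (sval X) (sval Y))
    (fun X => idm (sval X)) (fun X Y Z => @comp C (sval X) (sval Y) (sval Z))
    (fun _ _ => @comp1m C _ _) (fun _ _ => @compm1 C _ _)
    (fun _ _ _ _ => @compA C _ _ _ _).

Definition full_symmon : symmon.
Proof.
refine (@SymMon full_category (exist _ unitob P1)
  (fun X Y => exist _ (sval X ⊗ sval Y) (PM (proj2_sig X) (proj2_sig Y)))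
  (fun X X' Y Y' => @tens C (sval X) (sval X') (sval Y) (sval Y'))
  (fun X Y Z => assoc (sval X) (sval Y) (sval Z))
  (fun X Y Z => associ (sval X) (sval Y) (sval Z))
  (fun X => lunit (sval X)) (fun X => luniti (sval X))
  (fun X => runit (sval X)) (fun X => runiti (sval X))
  (fun X Y => swap (sval X) (sval Y)) _ _ _ _ _ _ _ _ _ _ _ _ _ _ _ _).
- by move=> *; exact: tens1.
- by move=> *; exact: tens_comp.
- by move=> *; exact: assocK.
- by move=> *; exact: associK.
- by move=> *; exact: lunitK.
- by move=> *; exact: lunitiK.
- by move=> *; exact: runitK.
- by move=> *; exact: runitiK.
- by move=> *; exact: swapK.
- by move=> *; exact: assoc_nat.
- by move=> *; exact: lunit_nat.
- by move=> *; exact: runit_nat.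
- by move=> *; exact: swap_nat.
- by move=> *; exact: pentagon.
- by move=> *; exact: triangle.
- by move=> *; exact: hexagon.
Defined.

Definition full_markov : markov.
Proof.
refine (@Markov full_symmon (fun X => copy (sval X)) (fun X => del (sval X))
  _ _ _ _ _ _).
- by move=> *; exact: copyA.
- by move=> *; exact: copy1.
- by move=> *; exact: copyC.
- by move=> *; exact: copy_tens.
- by move=> *; exact: del_tens.
- by move=> *; exact: del_nat.
Defined.

End FullMarkov.

Import Order.TTheory GRing.Theory Num.Theory.
Local Open Scope ring_scope.

Section FinStoch.
Variable R : realType.
Implicit Types X Y Z : finType.

(* [f x y] is the probability of [y] given [x]: the rows sum to 1. *)
Record stochastic X Y := Stochastic {
  stmx :> X -> Y -> R;
  stmx_ge0 : forall x y, 0 <= stmx x y;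
  stmx_sum1 : forall x, \sum_y stmx x y = 1
}.

Lemma stochastic_ext X Y (f g : stochastic X Y) :
  (forall x y, f x y = g x y) -> f = g.
Proof.
case: f g => [f f0 f1] [g g0 g1] /= fg.
have {}fg : f = g by apply/funext => x; apply/funext => y; exact: fg.
by subst g; congr Stochastic; exact: Prop_irrelevance.
Qed.

Program Definition stfun X Y (phi : X -> Y) : stochastic X Y :=
  @Stochastic X Y (fun x y => (phi x == y)%:R) _ _.
Next Obligation. by move=> *; rewrite ler0n. Qed.
Next Obligation.
move=> X Y phi x; rewrite (bigD1 (phi x))//= eqxx big1 ?addr0// => y.
by rewrite eq_sym => /negPf ->.
Qed.

Program Definition stcomp X Y Z (g : stochastic Y Z) (f : stochastic X Y) :
    stochastic X Z :=
  @Stochastic X Z (fun x z => \sum_y f x y * g y z) _ _.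
Next Obligation.
by move=> *; apply: sumr_ge0 => y _; rewrite mulr_ge0// stmx_ge0.
Qed.
Next Obligation.
move=> X Y Z g f x; rewrite exchange_big/= -(stmx_sum1 f x).
by apply: eq_bigr => y _; rewrite -mulr_sumr stmx_sum1 mulr1.
Qed.

Program Definition sttens X X' Y Y' (f : stochastic X X')
    (g : stochastic Y Y') : stochastic (X * Y)%type (X' * Y')%type :=
  @Stochastic _ _ (fun x y => f x.1 y.1 * g x.2 y.2) _ _.
Next Obligation. by move=> *; rewrite mulr_ge0// stmx_ge0. Qed.
Next Obligation.
move=> X X' Y Y' f g x.
rewrite -(pair_big xpredT xpredT (fun a b => f x.1 a * g x.2 b))/=.
rewrite -(stmx_sum1 f x.1); apply: eq_bigr => y _.
by rewrite -mulr_sumr stmx_sum1 mulr1.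
Qed.

Lemma stcomp_funr X Y Z (g : stochastic Y Z) (phi : X -> Y) x z :
  stcomp g (stfun phi) x z = g (phi x) z.
Proof.
rewrite /= (bigD1 (phi x))//= eqxx mul1r big1 ?addr0// => y.
by rewrite eq_sym => /negPf ->; rewrite mul0r.
Qed.

Lemma stcomp_funl X Y Z (phi : Y -> Z) (psi : Z -> Y) (f : stochastic X Y) x z :
  cancel phi psi -> cancel psi phi -> stcomp (stfun phi) f x z = f x (psi z).
Proof.
move=> phiK psiK; rewrite /= (bigD1 (psi z))//= psiK eqxx mulr1.
rewrite big1 ?addr0// => y /negPf yz.
by rewrite (can2_eq phiK psiK) yz mulr0.
Qed.

Lemma stcomp_fun X Y Z (phi : Y -> Z) (psi : X -> Y) :
  stcomp (stfun phi) (stfun psi) = stfun (phi \o psi).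
Proof. by apply: stochastic_ext => x z; rewrite stcomp_funr. Qed.

Lemma sttens_fun X X' Y Y' (phi : X -> X') (psi : Y -> Y') :
  sttens (stfun phi) (stfun psi) = stfun (fun z => (phi z.1, psi z.2)).
Proof.
apply: stochastic_ext => -[x y] [x' y'] /=.
by rewrite xpair_eqE -natrM mulnb.
Qed.

Lemma sttens_comp X X' X'' Y Y' Y'' (f' : stochastic X' X'')
    (f : stochastic X X') (g' : stochastic Y' Y'') (g : stochastic Y Y') :
  sttens (stcomp f' f) (stcomp g' g) = stcomp (sttens f' g') (sttens f g).
Proof.
apply: stochastic_ext => -[x y] [x' y'] /=.
rewrite mulr_suml.
rewrite -(pair_big xpredT xpredT
  (fun a b => f x a * g y b * (f' a x' * g' b y')))/=.
by apply: eq_bigr => a _; rewrite mulr_sumr; apply: eq_bigr => b _; rewrite mulrACA.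
Qed.

Definition FinStoch_category : category.
Proof.
refine (@Category finType stochastic (fun X => stfun id) stcomp _ _ _).
- by move=> X Y f; apply: stochastic_ext => x y; rewrite (stcomp_funl (psi := id)).
- by move=> X Y f; apply: stochastic_ext => x y; rewrite stcomp_funr.
- move=> X Y Z W h g f; apply: stochastic_ext => x w /=.
  under eq_bigr do rewrite mulr_suml.
  rewrite exchange_big/=; apply: eq_bigr => y _; rewrite mulr_sumr.
  by apply: eq_bigr => z _; rewrite mulrA.
Defined.

Definition FinStoch_symmon : symmon.
Proof.
refine (@SymMon FinStoch_category unit (fun X Y : finType => (X * Y)%type : finType)
  sttens
  (fun X Y Z => stfun (fun t : X * Y * Z => (t.1.1, (t.1.2, t.2))))
  (fun X Y Z => stfun (fun t : X * (Y * Z) => ((t.1, t.2.1), t.2.2)))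
  (fun X => stfun (fun t : unit * X => t.2))
  (fun X => stfun (fun x : X => (tt, x)))
  (fun X => stfun (fun t : X * unit => t.1))
  (fun X => stfun (fun x : X => (x, tt)))
  (fun X Y => stfun (fun t : X * Y => (t.2, t.1)))
  _ _ _ _ _ _ _ _ _ _ _ _ _ _ _ _).
- by move=> X Y /=; rewrite sttens_fun; congr stfun; apply/funext => -[].
- by move=> *; exact: sttens_comp.
- by move=> X Y Z /=; rewrite stcomp_fun; congr stfun; apply/funext => -[[]].
- by move=> X Y Z /=; rewrite stcomp_fun; congr stfun; apply/funext => -[? []].
- by move=> X /=; rewrite stcomp_fun; congr stfun; apply/funext => -[[]].
- by move=> X /=; rewrite stcomp_fun.
- by move=> X /=; rewrite stcomp_fun; congr stfun; apply/funext => -[? []].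
- by move=> X /=; rewrite stcomp_fun.
- by move=> X Y /=; rewrite stcomp_fun; congr stfun; apply/funext => -[].
- move=> X X' Y Y' Z Z' f g h; apply: stochastic_ext => -[[x y] z] [x' [y' z']].
  rewrite [RHS]stcomp_funr.
  rewrite [LHS](stcomp_funl (psi := fun t => ((t.1, t.2.1), t.2.2))).
  + by rewrite /= mulrA.
  + by move=> [[]].
  + by move=> [? []].
- move=> X X' f; apply: stochastic_ext => -[[] x] x'.
  rewrite [RHS]stcomp_funr.
  rewrite [LHS](stcomp_funl (psi := fun x => (tt, x))) => //.
  + by rewrite /= mul1r.
  + by move=> [[]].
- move=> X X' f; apply: stochastic_ext => -[x []] x'.
  rewrite [RHS]stcomp_funr.
  rewrite [LHS](stcomp_funl (psi := fun x => (x, tt))) => //.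
  + by rewrite /= mulr1.
  + by move=> [? []].
- move=> X X' Y Y' f g; apply: stochastic_ext => -[x y] [y' x'].
  rewrite [RHS]stcomp_funr.
  rewrite [LHS](stcomp_funl (psi := fun t => (t.2, t.1))).
  + by rewrite /= mulrC.
  + by move=> [].
  + by move=> [].
- by move=> X Y Z W /=; rewrite !(stcomp_fun, sttens_fun).
- by move=> X Y /=; rewrite !(stcomp_fun, sttens_fun).
- by move=> X Y Z /=; rewrite !(stcomp_fun, sttens_fun).
Defined.

Definition FinStoch : markov.
Proof.
refine (@Markov FinStoch_symmon (fun X : finType => stfun (fun x : X => (x, x)))
  (fun X : finType => stfun (fun x : X => tt)) _ _ _ _ _ _).
- by move=> X /=; rewrite !(stcomp_fun, sttens_fun).
- by move=> X /=; rewrite !(stcomp_fun, sttens_fun).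
- by move=> X /=; rewrite !(stcomp_fun, sttens_fun).
- move=> X Y; rewrite /interchange /= !(stcomp_fun, sttens_fun).
  by congr stfun; apply/funext => -[].
- by move=> X Y /=; rewrite !(stcomp_fun, sttens_fun).
- move=> X Y f; apply: stochastic_ext => x [].
  rewrite /= [RHS](_ : _ = 1)// -[RHS](stmx_sum1 f x); apply: eq_bigr => y _.
  exact: mulr1.
Defined.

End FinStoch.

Section esum_complements.
Local Open Scope ereal_scope.
Variable R : realType.

Lemma esumZl (T : choiceType) (c : R) (a : T -> \bar R) :
  (0 <= c)%R -> (forall x, 0 <= a x) ->
  \esum_(x in [set: T]) (c%:E * a x) = c%:E * \esum_(x in [set: T]) a x.
Proof.
move=> c0 a0; rewrite /esum -ereal_supZl//; last first.
  by apply/set0P; exists (\sum_(x \in set0) a x), set0 => //; exact: fsets_set0.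
congr ereal_sup; apply/seteqP; split=> [_ [A FA <-]|_ [_ [A FA <-] <-]].
  by exists (\sum_(x \in A) a x); [exists A|rewrite ge0_mule_fsumr].
by exists A => //; rewrite ge0_mule_fsumr.
Qed.

Lemma esum_point (T : choiceType) (t : T) (a : T -> \bar R) :
  (forall x, 0 <= a x) -> (forall x, x <> t -> a x = 0) ->
  \esum_(x in [set: T]) a x = a t.
Proof.
move=> a0 at0.
by rewrite (esumID [set t])// !setTI esum_set1// esum1 ?adde0.
Qed.

Lemma esum_pair (S T : choiceType) (a : S -> T -> \bar R) :
  (forall x y, 0 <= a x y) ->
  \esum_(z in [set: S * T]) a z.1 z.2
  = \esum_(x in [set: S]) \esum_(y in [set: T]) a x y.
Proof.
move=> a0; rewrite (@esum_esum R S T setT (fun=> setT) a)//.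
by congr esum; apply/seteqP; split.
Qed.

Lemma esum_exchange (S T : choiceType) (a : S -> T -> \bar R) :
  (forall x y, 0 <= a x y) ->
  \esum_(x in [set: S]) \esum_(y in [set: T]) a x y
  = \esum_(y in [set: T]) \esum_(x in [set: S]) a x y.
Proof.
move=> a0; rewrite -esum_pair// -(@esum_pair T S (fun y x => a x y))//.
rewrite (@reindex_esum R (T * S)%type (S * T)%type setT setT (fun z => (z.2, z.1)))//.
split=> //; first by move=> [x y] [x' y'] _ _ [-> ->].
by move=> [x y] _; exists (y, x).
Qed.

Lemma esum_classic_pair (S T : Type) (a : S * T -> \bar R) :
  \esum_(z in [set: {classic S * T}]) a z
  = \esum_(z in [set: ({classic S} * {classic T})%type]) a z.
Proof.
rewrite (@reindex_esum R ({classic S} * {classic T})%type {classic S * T}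
  setT setT id)//.
by split=> // z _; exists z.
Qed.

End esum_complements.

Section SetDelta.
Variable R : realType.
Implicit Types X Y Z : smallset.

(* A family of nonnegative reals with sum 1 has countable support. *)
Record dist X := Dist {
  pmf :> X -> R;
  pmf_ge0 : forall x, 0 <= pmf x;
  pmf_sum1 : \esum_(x in [set: {classic X}]) (pmf x)%:E = 1%E
}.

Lemma dist_ext X (p q : dist X) : (forall x, p x = q x) -> p = q.
Proof.
case: p q => [p p0 p1] [q q0 q1] /= /funext pq.
by subst q; congr Dist; exact: Prop_irrelevance.
Qed.

Lemma pmf_le1 X (p : dist X) x : p x <= 1.
Proof.
rewrite -lee_fin -(pmf_sum1 p) (esumID [set (x : {classic X})]) ?setTI.
  rewrite esum_set1 ?lee_fin ?pmf_ge0// leeDl// esum_ge0// => y _.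
  by rewrite lee_fin pmf_ge0.
by move=> y _; rewrite lee_fin pmf_ge0.
Qed.

Program Definition dret X (x : X) : dist X :=
  @Dist X (fun y => `[< x = y >]%:R) _ _.
Next Obligation. by move=> *; rewrite ler0n. Qed.
Next Obligation.
move=> X x; rewrite (@esum_point R {classic X} x) => [|y|y yx].
- by rewrite asboolT.
- by rewrite lee_fin ler0n.
- by rewrite asboolF// => /esym.
Qed.

Lemma dbind_fin X Y (p : dist X) (f : X -> dist Y) y :
  (\esum_(x in [set: {classic X}]) (p x * f x y)%:E \is a fin_num)%E.
Proof.
rewrite ge0_fin_numE; last first.
  by apply: esum_ge0 => x _; rewrite lee_fin mulr_ge0// pmf_ge0.
rewrite (@le_lt_trans _ _ 1%E) ?ltry// -(pmf_sum1 p).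
apply: le_esum => x _; rewrite lee_fin.
by rewrite -[leRHS]mulr1 ler_wpM2l ?pmf_ge0 ?pmf_le1.
Qed.

Program Definition dbind X Y (p : dist X) (f : X -> dist Y) : dist Y :=
  @Dist Y (fun y => fine (\esum_(x in [set: {classic X}]) (p x * f x y)%:E)) _ _.
Next Obligation.
move=> X Y p f y; apply/fine_ge0/esum_ge0 => x _.
by rewrite lee_fin mulr_ge0// pmf_ge0.
Qed.
Next Obligation.
move=> X Y p f; under eq_esum do rewrite fineK ?dbind_fin//.
rewrite esum_exchange; last by move=> *; rewrite lee_fin mulr_ge0// pmf_ge0.
rewrite -[RHS](pmf_sum1 p); apply: eq_esum => x _.
under eq_esum do rewrite EFinM.
rewrite esumZl ?pmf_ge0//; last by move=> y; rewrite lee_fin pmf_ge0.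
by rewrite pmf_sum1 mule1.
Qed.

Lemma dbindE X Y (p : dist X) (f : X -> dist Y) y :
  (dbind p f y)%:E = (\esum_(x in [set: {classic X}]) (p x * f x y)%:E)%E.
Proof. by rewrite /= fineK ?dbind_fin. Qed.

Program Definition dprod X Y (p : dist X) (q : dist Y) : dist (X * Y)%type :=
  @Dist _ (fun z => p z.1 * q z.2) _ _.
Next Obligation. by move=> *; rewrite mulr_ge0// pmf_ge0. Qed.
Next Obligation.
move=> X Y p q; rewrite esum_classic_pair.
rewrite (@esum_pair R {classic X} {classic Y} (fun x y => (p x * q y)%:E)); last first.
  by move=> *; rewrite lee_fin mulr_ge0// pmf_ge0.
rewrite -[RHS](pmf_sum1 p); apply: eq_esum => x _.
under eq_esum do rewrite EFinM.
rewrite esumZl ?pmf_ge0//; last by move=> y; rewrite lee_fin pmf_ge0.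
by rewrite pmf_sum1 mule1.
Qed.

Lemma dbind_ret X Y (x : X) (f : X -> dist Y) : dbind (dret x) f = f x.
Proof.
apply: dist_ext => y; apply: EFin_inj; rewrite dbindE.
rewrite (@esum_point R {classic X} x) => [|x'|x' xx'].
- by rewrite /= asboolT// mul1r.
- by rewrite lee_fin mulr_ge0// pmf_ge0.
- by rewrite /= asboolF ?mul0r// => /esym.
Qed.

Lemma dbind_fun X Y (phi : X -> Y) (psi : Y -> X) (p : dist X) y :
  cancel phi psi -> cancel psi phi ->
  dbind p (fun x => dret (phi x)) y = p (psi y).
Proof.
move=> phiK psiK; apply: EFin_inj; rewrite dbindE.
rewrite (@esum_point R {classic X} (psi y)) => [|x'|x' xx'].
- by rewrite /= psiK asboolT// mulr1.
- by rewrite lee_fin mulr_ge0// pmf_ge0.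
- rewrite /= asboolF ?mulr0// => xy; apply: xx'.
  by rewrite -xy phiK.
Qed.

Lemma dbindA X Y Z (p : dist X) (f : X -> dist Y) (g : Y -> dist Z) :
  dbind (dbind p f) g = dbind p (fun x => dbind (f x) g).
Proof.
apply: dist_ext => z; apply: EFin_inj; rewrite !dbindE.
under eq_esum => y _.
  rewrite EFinM dbindE muleC -esumZl ?pmf_ge0//; last first.
    by move=> *; rewrite lee_fin mulr_ge0// pmf_ge0.
  over.
rewrite esum_exchange; last first.
  by move=> *; rewrite lee_fin !mulr_ge0// pmf_ge0.
apply: eq_esum => x _; rewrite EFinM dbindE -esumZl ?pmf_ge0//; last first.
  by move=> *; rewrite lee_fin mulr_ge0// pmf_ge0.
by apply: eq_esum => y _; rewrite -!EFinM mulrC mulrA.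
Qed.

Lemma dprod_ret X Y (x : X) (y : Y) : dprod (dret x) (dret y) = dret (x, y).
Proof.
apply: dist_ext => -[x' y'] /=; rewrite -natrM mulnb -asbool_and.
congr (_ %:R); congr nat_of_bool; apply: asbool_equiv_eq.
by split=> [[-> ->]|[-> ->]].
Qed.

Lemma dprod_bind X X' Y Y' (p : dist X) (f : X -> dist X') (q : dist Y)
    (g : Y -> dist Y') :
  dprod (dbind p f) (dbind q g)
  = dbind (dprod p q) (fun z => dprod (f z.1) (g z.2)).
Proof.
apply: dist_ext => -[x' y']; apply: EFin_inj; rewrite dbindE esum_classic_pair.
rewrite (@esum_pair R {classic X} {classic Y}
  (fun x y => (p x * q y * (f x x' * g y y'))%:E)); last first.
  by move=> *; rewrite lee_fin !mulr_ge0// pmf_ge0.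
rewrite [LHS]EFinM muleC (dbindE p) -esumZl ?pmf_ge0//; last first.
  by move=> *; rewrite lee_fin mulr_ge0// pmf_ge0.
apply: eq_esum => x _.
rewrite muleC (dbindE q) -esumZl ?mulr_ge0 ?pmf_ge0//; last first.
  by move=> *; rewrite lee_fin mulr_ge0// pmf_ge0.
by apply: eq_esum => y _; rewrite -EFinM mulrACA.
Qed.

Lemma dist_unit (p : dist unit) : p = dret tt.
Proof.
apply: dist_ext => -[]; apply: EFin_inj; rewrite /= asboolT//.
rewrite -(pmf_sum1 p) (@esum_point R {classic unit} tt)// => -[] //.
by rewrite lee_fin pmf_ge0.
Qed.

Definition kernel X Y := X -> dist Y.
Definition kfun X Y (phi : X -> Y) : kernel X Y := fun x => dret (phi x).
Definition kcomp X Y Z (g : kernel Y Z) (f : kernel X Y) : kernel X Z :=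
  fun x => dbind (f x) g.
Definition ktens X X' Y Y' (f : kernel X X') (g : kernel Y Y') :
    kernel (X * Y)%type (X' * Y')%type :=
  fun z => dprod (f z.1) (g z.2).

Lemma kernel_ext X Y (f g : kernel X Y) : (forall x y, f x y = g x y) -> f = g.
Proof. by move=> fg; apply/funext => x; apply: dist_ext. Qed.

Lemma kcomp_funr X Y Z (g : kernel Y Z) (phi : X -> Y) x z :
  kcomp g (kfun phi) x z = g (phi x) z.
Proof. by rewrite /kcomp dbind_ret. Qed.

Lemma kcomp_funl X Y Z (phi : Y -> Z) (psi : Z -> Y) (f : kernel X Y) x z :
  cancel phi psi -> cancel psi phi -> kcomp (kfun phi) f x z = f x (psi z).
Proof. exact: dbind_fun. Qed.

Lemma kcomp_fun X Y Z (phi : Y -> Z) (psi : X -> Y) :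
  kcomp (kfun phi) (kfun psi) = kfun (phi \o psi).
Proof. by apply: kernel_ext => x z; rewrite kcomp_funr. Qed.

Lemma ktens_fun X X' Y Y' (phi : X -> X') (psi : Y -> Y') :
  ktens (kfun phi) (kfun psi) = kfun (fun z => (phi z.1, psi z.2)).
Proof. by apply/funext => x; exact: dprod_ret. Qed.

(* The Kleisli category: the identities are the Dirac kernels [dret] and
   [kcomp] is the Kleisli composition. *)
Definition SetDelta_category : category.
Proof.
refine (@Category smallset kernel (fun X => kfun id) kcomp _ _ _).
- by move=> X Y f; apply: kernel_ext => x y; rewrite (kcomp_funl (psi := id)).
- by move=> X Y f; apply: kernel_ext => x y; rewrite kcomp_funr.
- by move=> X Y Z W h g f; apply/funext => x; rewrite /kcomp dbindA.
Defined.

Definition SetDelta_symmon : symmon.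
Proof.
refine (@SymMon SetDelta_category unit (fun X Y : smallset => (X * Y)%type)
  ktens
  (fun X Y Z => kfun (fun t : X * Y * Z => (t.1.1, (t.1.2, t.2))))
  (fun X Y Z => kfun (fun t : X * (Y * Z) => ((t.1, t.2.1), t.2.2)))
  (fun X => kfun (fun t : unit * X => t.2))
  (fun X => kfun (fun x : X => (tt, x)))
  (fun X => kfun (fun t : X * unit => t.1))
  (fun X => kfun (fun x : X => (x, tt)))
  (fun X Y => kfun (fun t : X * Y => (t.2, t.1)))
  _ _ _ _ _ _ _ _ _ _ _ _ _ _ _ _).
- by move=> X Y /=; rewrite ktens_fun; congr kfun; apply/funext => -[].
- by move=> *; apply/funext => -[x y]; exact: dprod_bind.
- by move=> X Y Z /=; rewrite kcomp_fun; congr kfun; apply/funext => -[[]].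
- by move=> X Y Z /=; rewrite kcomp_fun; congr kfun; apply/funext => -[? []].
- by move=> X /=; rewrite kcomp_fun; congr kfun; apply/funext => -[[]].
- by move=> X /=; rewrite kcomp_fun.
- by move=> X /=; rewrite kcomp_fun; congr kfun; apply/funext => -[? []].
- by move=> X /=; rewrite kcomp_fun.
- by move=> X Y /=; rewrite kcomp_fun; congr kfun; apply/funext => -[].
- move=> X X' Y Y' Z Z' f g h; apply: kernel_ext => -[[x y] z] [x' [y' z']].
  rewrite [RHS]kcomp_funr.
  rewrite [LHS](kcomp_funl (psi := fun t => ((t.1, t.2.1), t.2.2))).
  + by rewrite /= mulrA.
  + by move=> [[]].
  + by move=> [? []].
- move=> X X' f; apply: kernel_ext => -[[] x] x'.
  rewrite [RHS]kcomp_funr.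
  rewrite [LHS](kcomp_funl (psi := fun x => (tt, x))) => //.
  + by rewrite /= asboolT// mul1r.
  + by move=> [[]].
- move=> X X' f; apply: kernel_ext => -[x []] x'.
  rewrite [RHS]kcomp_funr.
  rewrite [LHS](kcomp_funl (psi := fun x => (x, tt))) => //.
  + by rewrite /= asboolT// mulr1.
  + by move=> [? []].
- move=> X X' Y Y' f g; apply: kernel_ext => -[x y] [y' x'].
  rewrite [RHS]kcomp_funr.
  rewrite [LHS](kcomp_funl (psi := fun t => (t.2, t.1))).
  + by rewrite /= mulrC.
  + by move=> [].
  + by move=> [].
- by move=> X Y Z W /=; rewrite !(kcomp_fun, ktens_fun).
- by move=> X Y /=; rewrite !(kcomp_fun, ktens_fun).
- by move=> X Y Z /=; rewrite !(kcomp_fun, ktens_fun).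
Defined.

Definition SetDelta : markov.
Proof.
refine (@Markov SetDelta_symmon (fun X : smallset => kfun (fun x : X => (x, x)))
  (fun X : smallset => kfun (fun x : X => tt)) _ _ _ _ _ _).
- by move=> X /=; rewrite !(kcomp_fun, ktens_fun).
- by move=> X /=; rewrite !(kcomp_fun, ktens_fun).
- by move=> X /=; rewrite !(kcomp_fun, ktens_fun).
- move=> X Y; rewrite /interchange /= !(kcomp_fun, ktens_fun).
  by congr kfun; apply/funext => -[].
- by move=> X Y /=; rewrite !(kcomp_fun, ktens_fun).
- by move=> X Y f; apply/funext => x; rewrite [LHS]dist_unit.
Defined.

Definition SetDelta_lt (K : smallset) (regK : infinite_regular K) : markov :=
  @full_markov SetDelta (fun X : smallset => card_lt X K)
    (card_lt_unit regK) (fun X Y => @card_lt_prod K X Y regK).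

End SetDelta.

(* Main.v *)
From mathcomp Require Import all_boot all_order all_algebra.
From mathcomp Require Import boolp classical_sets functions cardinality fsbigop.
From mathcomp Require Import reals ereal esum topology normedtype sequences.
From mathcomp Require Import ring lra zify.
Require Import Defs.

(** The heart of the matter is that [dist R X], the set of countably supported
probability distributions on [X], is the free iterable midpoint algebra on [X]
([dist_free_exists], [dist_free_unique]).

Every distribution is the midpoint of another distribution and of a uniform
distribution on a list of [2 ^ n] points ([dist_split]). Hence a midpoint
homomorphism from [dist R X] to an iterable algebra [A] solves an iteration
problem with state set [dist R X], so it is determined by its values on Dirac
distributions. Conversely, the solution [u] of that problem is the desired
homomorphism as soon as it is independent of the chosen splittings. An iterable
midpoint algebra need not be cancellative, so this cannot be obtained by
subtracting equal parts in [A]; it is proved by coinduction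
([iterable_coind]). If [p + d] and [q + c] are the same distribution, with [d]
and [c] uniform on lists, then one more splitting of [p] and of [q] exposes
three quarters of the mass on both sides as lists. These two lists share half
of the total mass, and permuting the finite averages gives two expressions with
the same second midpoint, whose first components form a pair of the same kind
([common_refinement]).

On the categorical side, a coin flip is unique by an Eckmann-Hilton argument.
In relative form ([functor_midpoint]) it says that a functor preserving a
coproduct [X + X] preserves midpoints of morphisms out of [X]; this covers the
functors of the theorem and the tensor products with an object. The three categories of the theorem are full subcategories [C] of
the Kleisli category closed under tensor products and small coproducts
([kleisli_embedding]). In such a [C] each object [X] is the coproduct of its
points, and [hom unitob X] is the free iterable midpoint algebra on them. Given
a target [D], let [F X] be a coproduct of copies of the unit indexed by the
points of [X], and let [rho] extend the coproduct injections to a midpoint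
homomorphism from [hom unitob X] to [hom unitob (F X)]. Morphisms out of [F X],
and out of tensor products of such objects, are compared on the image of
[rho], and freeness gives [F f \circ rho p = rho (f \circ p)] and the formula
[Fmu_rho] for the monoidal structure. All functor laws then reduce to
identities between morphisms from the unit in [C]. The same comparison on
points produces the unique isomorphism between two such functors
([comparison_unique]). *)

Set Implicit Arguments.
Unset Strict Implicit.
Unset Printing Implicit Defensive.
Import Order.TTheory GRing.Theory Num.Theory.

(** * Averages over lists of length a power of two *)

Section Average.
Variables (A : Type) (m : midpoint_algebra A) (a0 : A).
Implicit Types s t p q : seq A.

(** The value [a0] is the dummy head of an empty list; it is never reached on a
list of length [2 ^ n]. *)
Fixpoint avg n s : A :=
  if n is n'.+1 then m (avg n' (take (2 ^ n') s)) (avg n' (drop (2 ^ n') s))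
  else head a0 s.

Lemma avg_cat n s t : size s = 2 ^ n -> avg n.+1 (s ++ t) = m (avg n s) (avg n t).
Proof. by move=> ss /=; rewrite take_size_cat ?drop_size_cat. Qed.

Lemma avg_double n s : size s = 2 ^ n -> avg n.+1 (s ++ s) = avg n s.
Proof. by move=> ss; rewrite avg_cat// mid_idem. Qed.

Lemma avg_nseq n a : avg n (nseq (2 ^ n) a) = a.
Proof.
elim: n => [//|n IH].
by rewrite expnS mul2n -addnn nseqD avg_cat ?size_nseq// IH mid_idem.
Qed.

(** This is the only place where a transposition mixes the two halves of the
tree. Commutativity brings the two entries into facing quarters, and the medial
law then moves them into one subtree. *)
Lemma avg_swap_middle n p q a b : size p = (2 ^ n).-1 -> size q = (2 ^ n).-1 ->
  m (avg n (rcons p a)) (avg n (b :: q)) = m (avg n (rcons p b)) (avg n (a :: q)).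
Proof.
elim: n p q => [|n IH] p q sp sq.
  move: sp sq; rewrite expn0 => /size0nil-> /size0nil-> /=; exact: mid_comm.
have n0 : 0 < 2 ^ n by rewrite expn_gt0.
rewrite -(cat_take_drop (2 ^ n) p) -(cat_take_drop (2 ^ n).-1 q).
set p1 := take _ p; set p2 := drop _ p; set q1 := take _ q; set q2 := drop _ q.
have sp1 : size p1 = 2 ^ n by rewrite size_take sp expnS; case: ifP; lia.
have sp2 : size p2 = (2 ^ n).-1 by rewrite size_drop sp expnS; lia.
have sq1 : size q1 = (2 ^ n).-1 by rewrite size_take sq expnS; case: ifP; lia.
have sq2 : size q2 = 2 ^ n by rewrite size_drop sq expnS; lia.
rewrite !rcons_cat -!cat_cons !avg_cat //= ?sq1 ?prednK//.
by rewrite (mid_comm m (avg n p1)) mid_medial IH// mid_medial (mid_comm m (avg n p1)).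
Qed.

Lemma avg_swap n p q a b : size (p ++ [:: a, b & q]) = 2 ^ n ->
  avg n (p ++ [:: a, b & q]) = avg n (p ++ [:: b, a & q]).
Proof.
elim: n p q => [|n IH] p q; first by rewrite expn0 size_cat /=; lia.
rewrite expnS size_cat [size (_ :: _)]/= => sz.
have [lt|] := leqP (size p + 2) (2 ^ n).
  rewrite /= !(take_cat, drop_cat) !ifF; try lia.
  set r := 2 ^ n - size p; have -> : r = (r - 2).+2 by rewrite /r; lia.
  congr (m _ _) => /=; apply: IH.
  by rewrite size_cat /= size_take; case: ifP; lia.
have [ge _|lt1 lt2] := leqP (2 ^ n) (size p).
  rewrite -(cat_take_drop (2 ^ n) p) -!catA.
  have sp : size (take (2 ^ n) p) = 2 ^ n by rewrite size_take; case: ifP; lia.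
  rewrite !avg_cat//; congr (m _ _); apply: IH.
  by rewrite size_cat size_drop /=; lia.
rewrite -(cat_rcons a) -(cat_rcons b p) !avg_cat ?size_rcons; try lia.
by rewrite avg_swap_middle//; lia.
Qed.

(** The prefix [p] makes the induction over permutations in [avg_perm] possible:
entries already in place are moved into it. *)
Lemma avg_move n p s q x : size (p ++ s ++ x :: q) = 2 ^ n ->
  avg n (p ++ s ++ x :: q) = avg n (p ++ x :: s ++ q).
Proof.
elim/last_ind: s q => [//|s y IH] q; rewrite !size_cat size_rcons/= => sz.
rewrite cat_rcons catA avg_swap; last by rewrite !size_cat/=; lia.
rewrite -catA IH; first by rewrite cat_rcons.
by rewrite !size_cat/=; lia.
Qed.

Lemma avg_perm (X : eqType) (f : X -> A) n p (s t : seq X) :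
  size (p ++ map f s) = 2 ^ n -> perm_eq s t ->
  avg n (p ++ map f s) = avg n (p ++ map f t).
Proof.
elim: s t p => [|x s IH] t p; first by move=> _; rewrite perm_sym => /perm_nilP->.
move=> sz st; have xt : x \in t by rewrite -(perm_mem st) mem_head.
case/splitPr: xt st => k l st.
have st' : perm_eq s (k ++ l).
  rewrite -(perm_cons x) (perm_trans st)//.
  by rewrite perm_catC /= perm_cons perm_catC.
move: (perm_size st); rewrite /= size_cat/= => sst.
rewrite map_cat /= avg_move; last first.
  rewrite -sz !size_cat/= !size_map.
  by move: sst => [->]; rewrite !addnS.
rewrite -!(cat_rcons (f x) p) -map_cat; apply: IH => //.
by rewrite cat_rcons.
Qed.

End Average.

Lemma avg_hom (A B : Type) (m : midpoint_algebra A) (l : midpoint_algebra B)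
    (a0 : A) (f : A -> B) : midpoint_hom m l f ->
  forall n s, f (avg m a0 n s) = avg l (f a0) n (map f s).
Proof.
move=> hf; elim=> [|n IH] s /=; first by case: s.
by rewrite hf !IH map_take map_drop.
Qed.

(** Repeating a list does not change its average, so any finite number of lists
can be brought to a common length. *)
Lemma avg_raise (X : Type) n N (s : seq X) : size s = 2 ^ n -> n <= N ->
  exists2 t : seq X, size t = 2 ^ N & forall (A : Type) (m : midpoint_algebra A) a f,
    avg m a N (map f t) = avg m a n (map f s).
Proof.
move=> ss /subnK<-; elim: (N - n) => [|k [t st tE]]; first by exists s.
exists (t ++ t) => [|A m a f]; first by rewrite size_cat st addSn expnS; lia.
by rewrite map_cat avg_double ?size_map// tE.
Qed.

(** * Countably supported distributions form an iterable midpoint algebra *)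

Section DistMidpoint.
Local Open Scope ring_scope.
Variable R : realType.
Implicit Types X Y : smallset.

Lemma half_ge0 (a b : R) : 0 <= a -> 0 <= b -> 0 <= (a + b) / 2.
Proof. by move=> *; rewrite divr_ge0// addr_ge0. Qed.

Lemma esum_half X (p q : {classic X} -> R) :
  (forall x, 0 <= p x) -> (forall x, 0 <= q x) ->
  (\esum_(x in [set: {classic X}]) ((p x + q x) / 2)%:E
   = (2^-1)%:E * (\esum_(x in [set: {classic X}]) (p x)%:E
                  + \esum_(x in [set: {classic X}]) (q x)%:E))%E.
Proof.
move=> p0 q0; rewrite -esumD; try by move=> *; rewrite lee_fin.
rewrite -esumZl ?invr_ge0//; last by move=> x; rewrite -EFinD lee_fin addr_ge0.
by apply: eq_esum => x _; rewrite -EFinD -EFinM mulrC.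
Qed.

Program Definition dmid X (p q : dist R X) : dist R X :=
  @Dist R X (fun x => (p x + q x) / 2) _ _.
Next Obligation. by move=> X p q x; rewrite half_ge0// pmf_ge0. Qed.
Next Obligation.
move=> X p q; rewrite esum_half; try exact: pmf_ge0.
by rewrite !pmf_sum1 -EFinD -EFinM mulVf.
Qed.

Lemma dmidE X (p q : dist R X) x :
  (dmid p q x)%:E = ((2^-1)%:E * ((p x)%:E + (q x)%:E))%E.
Proof. by rewrite -EFinD -EFinM mulrC. Qed.

Definition dist_mid X : midpoint_algebra (dist R X).
Proof.
apply: (@MidpointAlgebra _ (@dmid X)).
- by move=> p; apply: dist_ext => x /=; field.
- by move=> p q; apply: dist_ext => x /=; rewrite addrC.
- by move=> p q r s; apply: dist_ext => x /=; field.
Defined.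

Lemma dbind_mid X Y (p q : dist R X) (f : X -> dist R Y) :
  dbind (dmid p q) f = dmid (dbind p f) (dbind q f).
Proof.
apply: dist_ext => y; apply: EFin_inj; rewrite dmidE !dbindE -esum_half.
- by apply: eq_esum => x _ /=; congr EFin; field.
- by move=> x; rewrite mulr_ge0// pmf_ge0.
- by move=> x; rewrite mulr_ge0// pmf_ge0.
Qed.

Lemma dbind_mid_fun X Y (p : dist R X) (f g : X -> dist R Y) :
  dbind p (fun x => dmid (f x) (g x)) = dmid (dbind p f) (dbind p g).
Proof.
apply: dist_ext => y; apply: EFin_inj; rewrite dmidE !dbindE -esum_half.
- by apply: eq_esum => x _ /=; congr EFin; field.
- by move=> x; rewrite mulr_ge0// pmf_ge0.
- by move=> x; rewrite mulr_ge0// pmf_ge0.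
Qed.

Lemma dist_inh X (p : dist R X) : exists x, 0 < p x.
Proof.
apply: contrapT => /forallNP p0; have := pmf_sum1 p; rewrite esum1.
  by move=> /eqP; rewrite eqe eq_sym oner_eq0.
by move=> x _; congr EFin; apply/eqP; rewrite eq_le pmf_ge0 andbT leNgt; apply/negP.
Qed.

Lemma dret_id X (x : X) : dret R x x = 1.
Proof. by rewrite /= asboolT. Qed.

Lemma dret_neq X (x y : X) : x <> y -> dret R x y = 0.
Proof. by move=> xy; rewrite /= asboolF. Qed.

(** The waiting time for the first head. Mixing a sequence of distributions
along it is the explicit solution of the iteration that consumes the sequence. *)
Program Definition geo : dist R nat :=
  @Dist R nat (fun n => 2^-1 / 2 ^+ n) _ _.
Next Obligation. by move=> n; rewrite divr_ge0// exprn_ge0. Qed.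
Next Obligation.
rewrite (@reindex_esum R nat {classic nat} setT setT id)//; last first.
  by split=> // n _; exists n.
rewrite -nneseries_esumT; last by move=> n; rewrite lee_fin divr_ge0// exprn_ge0.
transitivity (\sum_(n <oo) (1 / (2 ^ (n + 1))%:R : R)%:E)%E.
  apply: eq_eseriesr => n _; congr EFin.
  by rewrite addn1 natrX exprS invfM mul1r.
apply/cvg_lim => //; have := @cvg_geometric_eseries_half R 1 0.
by rewrite expr0 divr1.
Qed.

Lemma geo_step : geo = dmid (dbind geo (fun n => dret R n.+1)) (dret R 0%N).
Proof.
apply: dist_ext => -[|n]; apply: EFin_inj; rewrite dmidE dbindE.
  rewrite esum1 => [|n _]; last by rewrite dret_neq// mulr0.
  by rewrite dret_id add0e -EFinM mulr1 /= expr0 divr1.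
rewrite (@esum_point R {classic nat} n) => [|k|k kn].
- rewrite dret_id (@dret_neq _ 0%N)// adde0 -EFinM /= mulr1 exprS.
  by rewrite invfM.
- by rewrite lee_fin mulr_ge0// pmf_ge0.
- by rewrite dret_neq ?mulr0// => -[].
Qed.

(** A solution is the mixture, along the waiting time [geo], of the outputs met
on the orbit of the state. It is unique since the difference of two solutions
is halved at each step. *)
Lemma dist_iterable X : iterable (dist_mid X).
Proof.
move=> S s; pose st n x := iter n (fun y => (s y).1) x.
pose u x := dbind geo (fun n => (s (st n x)).2).
have hu z : u z = dmid (u (s z).1) (s z).2.
  rewrite {1}/u {1}geo_step dbind_mid dbindA dbind_ret; congr (dmid _ _).
  congr dbind; apply/funext => n; rewrite dbind_ret.
  by rewrite /st iterSr.
exists u; split=> // v hv; apply/funext => x; apply: dist_ext => y.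
have bound n z : `|u z y - v z y| <= 1 / 2 ^+ n.
  elim: n z => [|n IH] z.
    rewrite divr1 ler_norml.
    have := pmf_ge0 (u z) y; have := pmf_le1 (u z) y.
    have := pmf_ge0 (v z) y; have := pmf_le1 (v z) y; lra.
  have -> : u z y - v z y = (u (s z).1 y - v (s z).1 y) / 2.
    by rewrite hu hv; move: (u _) (v _) => p q /=; field.
  rewrite normrM (ger0_norm (_ : 0 <= 2^-1)) ?invr_ge0//.
  by rewrite exprSr invfM mulrA ler_pM2r ?invr_gt0// IH.
apply/eqP; rewrite -subr_eq0 -normr_le0; apply/ler_addgt0Pl => e e0.
rewrite addr0; have [n ne] : exists n, 1 / 2 ^+ n < e.
  have [n ne] : exists n, e^-1 < n%:R.
    by exists (Num.Def.archi_bound e^-1); rewrite archi_boundP// invr_ge0 ltW.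
  exists n; rewrite div1r invf_plt ?posrE ?exprn_gt0//.
  rewrite (lt_trans ne)// -natrX ltr_nat; exact: ltn_expl.
exact: le_trans (bound n x) (ltW ne).
Qed.

End DistMidpoint.

(** * Splitting a uniform distribution off a distribution *)

Section Split.
Local Open Scope ring_scope.
Variables (R : realType) (X : smallset).
Implicit Types (p q v : dist R X) (s : seq {classic X}).

Lemma dist_sum_le1 v s : uniq s -> \sum_(x <- s) v x <= 1.
Proof.
move=> us; rewrite -lee_fin -(pmf_sum1 v) -sumEFin.
apply: esum_ge; exists [set` s]%classic; first by split=> //; exact: finite_seq.
by rewrite -fsbig_seq.
Qed.

Lemma size_le_mass v s (K : nat) :
  (forall x, (count_mem x s)%:R <= K%:R * v x) -> (size s <= K)%N.
Proof.
move=> h; rewrite -(ler_nat R).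
have -> : (size s)%:R = \sum_(x <- undup s) (count_mem x s)%:R :> R.
  rewrite -natr_sum; congr (_ %:R).
  rewrite -sum1_size -big_undup_iterop_count.
  by apply: eq_bigr => x _; rewrite Monoid.iteropE iter_addn addn0 mul1n.
rewrite -[leRHS]mulr1 (le_trans _ (ler_wpM2l _ (dist_sum_le1 v (undup_uniq s))))//.
by rewrite mulr_sumr; apply: ler_sum => x _.
Qed.

Definition unif (x0 : X) n s : dist R X :=
  avg (dist_mid R X) (dret R x0) n (map (@dret R X) s).

Lemma unifE x0 n s (x : {classic X}) : size s = (2 ^ n)%N ->
  unif x0 n s x = (count_mem x s)%:R / 2 ^+ n.
Proof.
elim: n s => [|n IH] s ss.
  case: s ss => [|y []]// _; rewrite expr0 divr1 /= addn0.
  by case: eqP => yx; [rewrite asboolT|rewrite asboolF].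
have st : size (take (2 ^ n) s) = (2 ^ n)%N.
  by rewrite size_takel// ss leq_exp2l.
have sd : size (drop (2 ^ n) s) = (2 ^ n)%N by rewrite size_drop ss expnS; lia.
rewrite -{2}(cat_take_drop (2 ^ n) s) count_cat natrD.
rewrite /unif /= -map_take -map_drop -/(unif _ _ _) -/(unif _ _ _) !IH//.
by rewrite exprS; field; rewrite expf_neq0.
Qed.

Lemma dist_large_seq p (a : R) : a < 1 ->
  exists2 s : seq {classic X}, uniq s & a < \sum_(x <- s) p x.
Proof.
move=> a1; have : (a%:E < \esum_(x in [set: {classic X}]) (p x)%:E)%E.
  by rewrite pmf_sum1 lte_fin.
move=> /ereal_sup_gt[_ [F [finF _] <-]] aF.
exists (finmap.enum_fset (fset_set F)); first exact: finmap.fset_uniq.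
by move: aF; rewrite fsbig_finite//= sumEFin lte_fin.
Qed.

Lemma dist_half p q : (forall x, q x <= 2 * p x) -> exists r, p = dmid r q.
Proof.
move=> qp; pose r x := 2 * p x - q x.
have r0 x : 0 <= r x by rewrite subr_ge0.
suff r1 : (\esum_(x in [set: {classic X}]) (r x)%:E = 1)%E.
  by exists (Dist r0 r1); apply: dist_ext => x /=; rewrite /r; field.
(* The total mass of [r] solves 1 = (t + 1) / 2. *)
have := esum_half r0 (pmf_ge0 q).
under eq_esum do rewrite /r subrK mulrAC mulfV// mul1r.
rewrite !pmf_sum1.
have := @esum_ge0 R {classic X} setT (fun x => (r x)%:E) (fun x _ => r0 x).
case: (esum _ _) => [t| |] //.
  move=> _; rewrite -EFinD -EFinM => -[t1]; congr EFin; lra.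
by rewrite addye// gt0_muley// lte_fin invr_gt0.
Qed.

(** A finite set of points carries more than three quarters of the mass. Rounding
the probabilities down to multiples of [1 / 2 ^ n.+1] loses at most [1 / 2 ^ n.+1]
for each of these points; for large [n] at least half of the mass remains, and
[2 ^ n] of the resulting units form the list. *)
Lemma dist_split x0 p : exists n (s : (2 ^ n).-tuple {classic X}) p',
  p = dmid p' (unif x0 n s).
Proof.
(* The excess of 3 / 4 over 1 / 2 absorbs one unit of rounding for each point of
   [F], because size F <= 2 ^ size F. *)
have [F uF pF] := @dist_large_seq p (3 / 4) ltac:(lra).
pose n := (size F).+1; pose k x := Num.truncn (2 ^+ n.+1 * p x).
pose l := flatten [seq nseq (k x) x | x : {classic X} <- F].
have kP x : (k x)%:R <= 2 ^+ n.+1 * p x < (k x).+1%:R.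
  by rewrite truncn_itv// mulr_ge0 ?pmf_ge0// exprn_ge0.
have cl (x : {classic X}) : (count_mem x l <= k x)%N.
  rewrite /l; elim: (F) uF => [//|y r IH] /= /andP[yr ur].
  rewrite count_cat count_nseq /=; have [yx|yx] := eqVneq y x; last exact: IH.
  rewrite mul1n yx (count_memPn _) ?addn0//; apply/negP => /flatten_mapP[z zr].
  by rewrite mem_nseq => /andP[_ /eqP xz]; rewrite yx xz zr in yr.
have sl : (2 ^ n <= size l)%N.
  have -> : size l = (\sum_(x <- F) k x)%N.
    rewrite size_flatten sumnE /shape -map_comp big_map.
    by apply: eq_bigr => x _ /=; rewrite size_nseq.
  have : 2 ^+ n.+1 * (3 / 4) <= \sum_(x <- F) ((k x)%:R + 1) :> R.
    rewrite (le_trans (ler_wpM2l _ (ltW pF))) ?exprn_ge0// mulr_sumr ler_sum// => x _.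
    by rewrite natr1 ltW//; have /andP[] := kP x.
  rewrite big_split /= -natr_sum big_const_seq count_predT iter_addr addr0 => h.
  rewrite -(ler_nat R) natrX.
  have : (size F)%:R <= 2 ^+ (size F) :> R by rewrite -natrX ler_nat ltnW// ltn_expl.
  move: h; rewrite /n !exprS; lra.
have ss : size (take (2 ^ n) l) == (2 ^ n)%N by rewrite size_takel.
exists n, (Tuple ss); apply: dist_half => x; rewrite unifE /= ?(eqP ss)//.
rewrite ler_pdivrMr ?exprn_gt0// mulrAC -exprS.
have /andP[+ _] := kP x; apply: le_trans; rewrite ler_nat (leq_trans _ (cl x))//.
by rewrite -{2}(cat_take_drop (2 ^ n) l) count_cat leq_addr.
Qed.

End Split.

(** * Distributions form the free iterable midpoint algebra *)

(** Coinduction: two functions that admit the same unfolding solve the same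
iteration problem. *)
Lemma iterable_coind (A : Type) (m : midpoint_algebra A) (S : smallset)
    (v w : S -> A) : iterable m ->
  (forall z, exists z' a, v z = m (v z') a /\ w z = m (w z') a) -> v = w.
Proof.
move=> itA vw; have [n nP] := choice vw; have [a aP] := choice nP.
have [u [_ uP]] := itA S (fun z => (n z, a z)).
have <- : u = v by apply: uP => z /=; exact: (aP z).1.
by apply: uP => z /=; exact: (aP z).2.
Qed.

Lemma seq_intersection (T : eqType) (D Q : seq T) : exists I D0 Q0,
  [/\ perm_eq D (D0 ++ I), perm_eq Q (Q0 ++ I) & forall x, x \in D0 -> x \notin Q0].
Proof.
elim: D Q => [|x D IH] Q; first by exists [::], [::], Q; split; rewrite ?cats0.
have [xQ|xQ] := boolP (x \in Q).
  have [I [D0 [Q0 [DI QI dj]]]] := IH (rem x Q).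
  exists (x :: I), D0, Q0; split=> //.
    by rewrite perm_sym perm_catC /= perm_cons perm_sym (perm_trans DI)// perm_catC.
  rewrite (perm_trans (perm_to_rem xQ))//.
  by rewrite perm_sym perm_catC /= perm_cons perm_sym (perm_trans QI)// perm_catC.
have [I [D0 [Q0 [DI QI dj]]]] := IH Q.
exists I, (x :: D0), Q0; split=> //; first by rewrite /= perm_cons.
move=> y; rewrite inE => /orP[/eqP->|/dj//].
by apply: contra xQ; rewrite (perm_mem QI) mem_cat => ->.
Qed.

Section Free.
Local Open Scope ring_scope.
Variables (R : realType) (X : smallset).
Implicit Types (p q v : dist R X).

(** With [2 ^ n.+2] units of mass in total, the pointwise maximum of [D] and [Q]
has at most [4 * 2 ^ n] units, so their intersection has at least
[3 + 3 - 4 = 2] times [2 ^ n] units. *)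
Lemma common_part v n (D Q : seq {classic X}) :
  size D = (3 * 2 ^ n)%N -> size Q = (3 * 2 ^ n)%N ->
  (forall x, (count_mem x D)%:R <= (2 ^ n.+2)%:R * v x) ->
  (forall x, (count_mem x Q)%:R <= (2 ^ n.+2)%:R * v x) ->
  exists (D0 Q0 : (2 ^ n).-tuple {classic X}) (e : (2 ^ n.+1).-tuple {classic X}),
    perm_eq D (D0 ++ e) /\ perm_eq Q (Q0 ++ e).
Proof.
move=> sD sQ cD cQ; have [I [D0 [Q0 [DI QI dj]]]] := seq_intersection D Q.
have := perm_size DI; have := perm_size QI; rewrite !size_cat sD sQ => sQI sDI.
have : (size (D0 ++ Q0 ++ I) <= 2 ^ n.+2)%N.
  apply: (@size_le_mass R X v) => x.
  have [xD|xD] := boolP (x \in D0).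
    apply: le_trans (cD x); rewrite (permP DI) !count_cat ler_nat.
    by rewrite (count_memPn (dj _ xD)) add0n.
  apply: le_trans (cQ x); rewrite (permP QI) !count_cat ler_nat.
  by rewrite (count_memPn xD) add0n.
rewrite !size_cat => sI; rewrite !expnS in sI.
have se : size (take (2 ^ n.+1) I) == (2 ^ n.+1)%N.
  by rewrite size_takel// expnS; lia.
have sD0 : size (D0 ++ drop (2 ^ n.+1) I) == (2 ^ n)%N.
  by rewrite size_cat size_drop expnS; apply/eqP; lia.
have sQ0 : size (Q0 ++ drop (2 ^ n.+1) I) == (2 ^ n)%N.
  by rewrite size_cat size_drop expnS; apply/eqP; lia.
exists (Tuple sD0), (Tuple sQ0), (Tuple se); split=> /=.
  rewrite (perm_trans DI)// -catA perm_cat2l perm_sym perm_catC.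
  by rewrite cat_take_drop.
rewrite (perm_trans QI)// -catA perm_cat2l perm_sym perm_catC.
by rewrite cat_take_drop.
Qed.

Variable x0 : X.

(** Formal dyadic combinations of points, kept as lists so that they can be
evaluated in every midpoint algebra before being compared as distributions. *)
Definition dyadic := {n : nat & (2 ^ n).-tuple {classic X}}.

Definition dyad n (s : (2 ^ n).-tuple {classic X}) : dyadic :=
  Tagged (fun n => (2 ^ n).-tuple {classic X}) s.

Definition dyadic_eval (A : Type) (m : midpoint_algebra A) (f : X -> A) (d : dyadic) :=
  avg m (f x0) (tag d) (map f (tagged d)).

Definition dyadic_dist (d : dyadic) := dyadic_eval (dist_mid R X) (@dret R X) d.

Lemma dyadic_distE n (s : (2 ^ n).-tuple {classic X}) (x : {classic X}) :
  dyadic_dist (dyad s) x = (count_mem x s)%:R / 2 ^+ n.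
Proof. by rewrite -(unifE R x0) ?size_tuple. Qed.

Lemma dyadic_eval_hom (A B : Type) (m : midpoint_algebra A)
    (l : midpoint_algebra B) (f : X -> A) (g : A -> B) :
  midpoint_hom m l g ->
  forall d, g (dyadic_eval m f d) = dyadic_eval l (g \o f) d.
Proof. by move=> hg d; rewrite /dyadic_eval (avg_hom _ hg) map_comp. Qed.

Lemma dyadic_raise d N : (tag d <= N)%N -> exists s : (2 ^ N).-tuple {classic X},
  forall (A : Type) (m : midpoint_algebra A) f,
    dyadic_eval m f (dyad s) = dyadic_eval m f d.
Proof.
move=> dN; have [t /eqP st tE] := avg_raise (size_tuple (tagged d)) dN.
by exists (Tuple st) => A m f; exact: tE.
Qed.

Lemma dyadic_mid d d' : exists c, forall (A : Type) (m : midpoint_algebra A) f,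
  dyadic_eval m f c = m (dyadic_eval m f d) (dyadic_eval m f d').
Proof.
have [s sE] := dyadic_raise (leq_maxl (tag d) (tag d')).
have [t tE] := dyadic_raise (leq_maxr (tag d) (tag d')).
have st : size (s ++ t) == (2 ^ (maxn (tag d) (tag d')).+1)%N.
  by rewrite size_cat !size_tuple expnS; lia.
exists (dyad (Tuple st)) => A m f; rewrite -sE -tE.
by rewrite -avg_cat ?size_map ?size_tuple// -map_cat.
Qed.

(** Both sides are averages of [2 ^ n.+2] entries, one quarter of which are equal
to [a]. The others are permuted: in [s ++ t ++ t] the outer list [t] counts
twice because it stands for half of the total weight. *)
Lemma dyadic_eval_perm (A : Type) (m : midpoint_algebra A) f a n
    (s t r : (2 ^ n).-tuple {classic X}) (e : (2 ^ n.+1).-tuple {classic X}) :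
  perm_eq (s ++ t ++ t) (r ++ e) ->
  m (m a (dyadic_eval m f (dyad s))) (dyadic_eval m f (dyad t))
  = m (m a (dyadic_eval m f (dyad r))) (dyadic_eval m f (dyad e)).
Proof.
move=> st; rewrite /dyadic_eval /=.
transitivity (avg m (f x0) n.+2 (nseq (2 ^ n) a ++ map f (s ++ t ++ t))).
  rewrite !map_cat catA avg_cat ?size_cat ?size_nseq ?size_map ?size_tuple//; last first.
    by rewrite expnS; lia.
  by rewrite !avg_cat ?size_nseq ?size_map ?size_tuple// avg_nseq mid_idem.
rewrite (avg_perm _ _ _ st); last first.
  by rewrite !(size_cat, size_map, size_nseq, size_tuple) !expnS; lia.
rewrite !map_cat catA avg_cat ?size_cat ?size_nseq ?size_map ?size_tuple//; last first.
  by rewrite expnS; lia.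
by rewrite avg_cat ?size_nseq// avg_nseq.
Qed.

Lemma dyadic_split p : exists p' d, p = dmid p' (dyadic_dist d).
Proof.
by have [n [s [p' pE]]] := dist_split x0 p; exists p', (dyad s).
Qed.

Lemma dmid_inj p p' q : dmid p q = dmid p' q -> p = p'.
Proof.
move=> pp'; apply: dist_ext => x.
have := congr1 (fun r : dist R X => r x) pp' => /= /(divIf _).
by move=> /(_ _)/addIr; apply; rewrite pnatr_eq0.
Qed.

(** The two expressions [m (m a _) _] on the left are the evaluations of the
given expansions in an arbitrary midpoint algebra, [a] standing for the value
of the unexpanded part. They are rewritten there, without any cancellation, so
that the outer part [e] is common; the remaining equation lives in [dist R X],
where cancellation is available. *)
Lemma common_refinement p d q c d' c' :
  dmid (dmid p (dyadic_dist d')) (dyadic_dist d)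
  = dmid (dmid q (dyadic_dist c')) (dyadic_dist c) ->
  exists d0 c0 e,
    [/\ dmid p (dyadic_dist d0) = dmid q (dyadic_dist c0),
      forall (A : Type) (m : midpoint_algebra A) f a,
        m (m a (dyadic_eval m f d')) (dyadic_eval m f d)
        = m (m a (dyadic_eval m f d0)) (dyadic_eval m f e) &
      forall (A : Type) (m : midpoint_algebra A) f a,
        m (m a (dyadic_eval m f c')) (dyadic_eval m f c)
        = m (m a (dyadic_eval m f c0)) (dyadic_eval m f e)].
Proof.
move=> pq; pose N := maxn (maxn (tag d) (tag d')) (maxn (tag c) (tag c')).
have [s sE] : exists s : (2 ^ N).-tuple {classic X}, forall A m f,
    @dyadic_eval A m f (dyad s) = dyadic_eval m f d.
  by apply: dyadic_raise; rewrite /N; lia.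
have [s' s'E] : exists s : (2 ^ N).-tuple {classic X}, forall A m f,
    @dyadic_eval A m f (dyad s) = dyadic_eval m f d'.
  by apply: dyadic_raise; rewrite /N; lia.
have [t tE] : exists s : (2 ^ N).-tuple {classic X}, forall A m f,
    @dyadic_eval A m f (dyad s) = dyadic_eval m f c.
  by apply: dyadic_raise; rewrite /N; lia.
have [t' t'E] : exists s : (2 ^ N).-tuple {classic X}, forall A m f,
    @dyadic_eval A m f (dyad s) = dyadic_eval m f c'.
  by apply: dyadic_raise; rewrite /N; lia.
move: pq; rewrite /dyadic_dist -sE -s'E -tE -t'E => pq.
have bound (r : dist R X) (k l : (2 ^ N).-tuple {classic X}) (x : {classic X}) :
    (count_mem x (k ++ l ++ l))%:R <= (2 ^ N.+2)%:R *
      dmid (dmid r (dyadic_dist (dyad k))) (dyadic_dist (dyad l)) x.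
  have rx := pmf_ge0 r x; have pN : 0 < 2 ^+ N :> R by rewrite exprn_gt0.
  rewrite (_ : dmid _ _ x = ((r x + dyadic_dist (dyad k) x) / 2
    + dyadic_dist (dyad l) x) / 2)// !dyadic_distE natrX !count_cat !natrD !exprS.
  rewrite -subr_ge0 (_ : _ - _ = 2 ^+ N * r x) ?mulr_ge0 ?exprn_ge0//.
  by field; rewrite gt_eqF.
have [D0 [Q0 [e [DE QE]]]] := @common_part
  (dmid (dmid p (dyadic_dist (dyad s'))) (dyadic_dist (dyad s))) N
  (s' ++ s ++ s) (t' ++ t ++ t) ltac:(rewrite !size_cat !size_tuple; lia)
  ltac:(rewrite !size_cat !size_tuple; lia) (bound p s' s)
  (fun x => ltac:(rewrite pq; exact: bound)).
exists (dyad D0), (dyad Q0), (dyad e); split.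
- apply: (@dmid_inj _ _ (dyadic_dist (dyad e))).
  have := dyadic_eval_perm (dist_mid R X) (@dret R X) p DE => /= <-.
  by have := dyadic_eval_perm (dist_mid R X) (@dret R X) q QE => /= <-.
- by move=> A m f a; rewrite -sE -s'E; exact: dyadic_eval_perm.
- by move=> A m f a; rewrite -tE -t'E; exact: dyadic_eval_perm.
Qed.

Lemma dist_hom_unique (A : Type) (m : midpoint_algebra A) (G H : dist R X -> A) :
  iterable m -> midpoint_hom (dist_mid R X) m G -> midpoint_hom (dist_mid R X) m H ->
  (forall x, G (dret R x) = H (dret R x)) -> G = H.
Proof.
move=> itA hG hH GH; apply: (iterable_coind itA) => p.
have [p' [d ->]] := dyadic_split p; exists p', (G (dyadic_dist d)).
split; first exact: hG.
rewrite hH; congr (m _ _); rewrite /dyadic_dist !(dyadic_eval_hom _ hH) !(dyadic_eval_hom _ hG).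
by congr dyadic_eval; apply/funext => x /=.
Qed.

(** The candidate [u] solves the iteration given by chosen splittings. The
coinduction [key] makes it independent of the choice; then [u] turns every
midpoint with a uniform distribution into a midpoint, and two further
iterations, on pairs and on one point, give the general case and the values on
Dirac distributions. *)
Lemma dist_hom_exists (A : Type) (m : midpoint_algebra A) (f : X -> A) :
  iterable m ->
  exists2 G, midpoint_hom (dist_mid R X) m G & forall x, G (dret R x) = f x.
Proof.
move=> itA; pose h := dyadic_eval m f.
have [r rP] := choice (fun p => dyadic_split p).
have [d dP] := choice rP.
have [u [uP _]] := itA (dist R X) (fun p => (r p, h (d p))).
rewrite /= in uP.
have key p q e c : dmid p (dyadic_dist e) = dmid q (dyadic_dist c) ->
    m (u p) (h e) = m (u q) (h c).
  pose S := {z : (dist R X * dyadic) * (dist R X * dyadic) |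
    dmid z.1.1 (dyadic_dist z.1.2) = dmid z.2.1 (dyadic_dist z.2.2)}.
  pose v (z : S) := m (u (sval z).1.1) (h (sval z).1.2).
  pose w (z : S) := m (u (sval z).2.1) (h (sval z).2.2).
  suff vw : v = w by move=> E; exact: (congr1 (@^~ (exist _ ((p, e), (q, c)) E : S)) vw).
  apply: (iterable_coind itA) => -[[[{}p {}e] [{}q {}c]] /= E].
  have E' := E; rewrite {1}(dP p) {1}(dP q) in E'.
  have [d0 [c0 [b [E0 h1 h2]]]] := common_refinement E'.
  exists (exist _ ((r p, d0), (r q, c0)) E0), (h b).
  by rewrite /v /w /= (uP p) (uP q) -h1 -h2.
(* [key] compares the given splitting of the midpoint with the chosen one. *)
have ud p e : u (dmid p (dyadic_dist e)) = m (u p) (h e).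
  by rewrite uP; apply: key; rewrite -dP.
exists u => [|x].
  have [v [_ vP]] := itA (dist R X * dist R X)%type
    (fun z => ((r z.1, r z.2), m (h (d z.1)) (h (d z.2)))).
  have e1 : v = fun z => u (dmid z.1 z.2).
    apply: vP => -[p q] /=.
    have [c cE] := dyadic_mid (d p) (d q); rewrite -cE -ud.
    congr u; rewrite {1}(dP p) {1}(dP q) /dyadic_dist cE.
    exact: (mid_medial (dist_mid R X)).
  have e2 : v = fun z => m (u z.1) (u z.2).
    by apply: vP => -[p q] /=; rewrite {1}(uP p) {1}(uP q) mid_medial.
  by move=> p q; have := congr1 (@^~ (p, q)) e2; rewrite e1.
have [v [_ vP]] := itA unit (fun _ => (tt, f x)).
have s1 : size [:: x : {classic X}] == (2 ^ 0)%N by [].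
have e1 : v = fun=> f x by apply: vP => z; rewrite mid_idem.
have e2 : v = fun=> u (dret R x).
  apply: vP => z /=; rewrite -[in LHS](mid_idem (dist_mid R X) (dret R x)).
  exact: (ud _ (dyad (Tuple s1))).
by have := congr1 (@^~ tt) e2; rewrite e1.
Qed.

End Free.

(** * Coproducts and coin flips in Markov categories *)

Lemma dep_choice (I : Type) (T : I -> Type) (P : forall i, T i -> Prop) :
  (forall i, exists y, P i y) -> exists f : forall i, T i, forall i, P i (f i).
Proof. by move=> h; exists (fun i => sval (cid (h i))) => i; case: cid. Qed.

Section Unit.
Variable C : markov.
Implicit Types X Y : C.

(** The axioms on [del] do not state this case. Counitality and commutativity of
[copy] identify [del unitob] with the symmetry conjugated by the unitor, an
involution, while naturality of [del] makes it idempotent. *)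
Lemma del_unit : del unitob = idm (unitob : C).
Proof.
have delE : del unitob = lunit unitob ∘ swap unitob unitob ∘ luniti (unitob : C).
  have e : lunit unitob ∘ (idm unitob ⊠ del unitob) ∘ copy unitob = del (unitob : C).
    by rewrite lunit_nat -compA del_nat.
  have -> : luniti unitob = (del unitob ⊠ idm unitob) ∘ copy (unitob : C).
    by rewrite -[LHS]compm1 -{1}copy1 !compA lunitK comp1m.
  by rewrite !compA -(compA (lunit _)) swap_nat compA -compA copyC.
have invol : del unitob ∘ del unitob = idm (unitob : C).
  rewrite delE !compA -(compA _ (luniti _)) lunitK compm1.
  by rewrite -(compA (lunit _)) swapK compm1 lunitiK.
by rewrite -invol del_nat.
Qed.

Lemma unit_terminal X (f g : hom X unitob) : f = g.
Proof. by rewrite -[f]comp1m -[g]comp1m -del_unit !del_nat. Qed.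

(** The powers of the unit are terminal as well, which settles all coherence
conditions between them. *)
Lemma unit2_terminal X (f g : hom X (unitob ⊗ unitob)) : f = g.
Proof.
rewrite -[f]comp1m -[g]comp1m -lunitK -!compA; congr (_ ∘ _).
exact: unit_terminal.
Qed.

Lemma unit3_terminal X (f g : hom X (unitob ⊗ (unitob ⊗ unitob))) : f = g.
Proof.
rewrite -[f]comp1m -[g]comp1m -lunitK -!compA; congr (_ ∘ _).
exact: unit2_terminal.
Qed.

Lemma del_det X (f : hom X unitob) : deterministic f.
Proof. exact: unit2_terminal. Qed.

Lemma det_inverse X Y (f : hom X Y) (g : hom Y X) :
  g ∘ f = idm X -> f ∘ g = idm Y -> deterministic f -> deterministic g.
Proof.
rewrite /deterministic => gf fg df.
rewrite -[LHS]comp1m -tens1 -gf tens_comp -compA (compA (f ⊠ f)) -df.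
by rewrite -compA fg compm1.
Qed.

Lemma tens_split X X' Y Y' (f : hom X Y) (g : hom X' Y') :
  f ⊠ g = (idm Y ⊠ g) ∘ (f ⊠ idm X').
Proof. by rewrite -tens_comp comp1m compm1. Qed.

Lemma tens_split' X X' Y Y' (f : hom X Y) (g : hom X' Y') :
  f ⊠ g = (f ⊠ idm Y') ∘ (idm X ⊠ g).
Proof. by rewrite -tens_comp comp1m compm1. Qed.

Lemma tens_compl X X' X'' Y Y' (f' : hom X' X'') (f : hom X X') (g : hom Y Y') :
  (f' ∘ f) ⊠ g = (f' ⊠ g) ∘ (f ⊠ idm Y).
Proof. by rewrite -tens_comp compm1. Qed.

Lemma tens_compr X X' X'' Y Y' (f' : hom X' X'') (f : hom X X') (g : hom Y Y') :
  g ⊠ (f' ∘ f) = (g ⊠ f') ∘ (idm Y ⊠ f).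
Proof. by rewrite -tens_comp compm1. Qed.

Lemma swap_conj X X' Y Y' (f : hom X Y) (g : hom X' Y') :
  f ⊠ g = swap Y' Y ∘ (g ⊠ f) ∘ swap X X'.
Proof. by rewrite swap_nat -compA swapK compm1. Qed.

End Unit.

Section Coproduct.
Variable C : category.

Lemma coproduct_joint_epi (I : smallset) (X : I -> C) S (inj : forall i, hom (X i) S)
    Y (h k : hom S Y) : is_coproduct inj ->
  (forall i, h ∘ inj i = k ∘ inj i) -> h = k.
Proof.
move=> cop hk; have [l [_ lP]] := cop Y (fun i => k ∘ inj i).
by rewrite -(lP h) // (lP k).
Qed.

Lemma coproduct_copair (I : smallset) (X : I -> C) S (inj : forall i, hom (X i) S)
    Y (f : forall i, hom (X i) Y) : is_coproduct inj ->
  exists h : hom S Y, forall i, h ∘ inj i = f i.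
Proof. by move=> /(_ Y f)[h [hP _]]; exists h. Qed.

Lemma is_coproductP (I : smallset) (X : I -> C) S (inj : forall i, hom (X i) S) :
  (forall Y (f : forall i, hom (X i) Y), exists h : hom S Y, forall i, h ∘ inj i = f i) ->
  (forall Y (h k : hom S Y), (forall i, h ∘ inj i = k ∘ inj i) -> h = k) ->
  is_coproduct inj.
Proof.
move=> ex un Y f; have [h hP] := ex Y f; exists h; split=> // k kP.
by apply: un => i; rewrite hP kP.
Qed.

Lemma is_iso_id (X : C) : is_iso (idm X).
Proof. by exists (idm X); rewrite comp1m. Qed.

Lemma coproduct_iso (I : smallset) (X X' : I -> C) S S'
    (inj : forall i, hom (X i) S) (phi : hom S S') (psi : forall i, hom (X' i) (X i)) :
  is_iso phi -> (forall i, is_iso (psi i)) ->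
  is_coproduct inj -> is_coproduct (fun i => phi ∘ inj i ∘ psi i).
Proof.
move=> [phi' [pK Kp]] ipsi cop.
have [psi' sK] := dep_choice ipsi.
apply: is_coproductP => Y.
  move=> f; have [h hP] := coproduct_copair (fun i => f i ∘ psi' i) cop.
  exists (h ∘ phi') => i; rewrite !compA -(compA h) pK compm1 hP.
  by rewrite -compA (sK i).1 compm1.
move=> h k hk; rewrite -[h]compm1 -[k]compm1 -Kp !compA; congr (_ ∘ _).
apply: (coproduct_joint_epi cop) => i.
rewrite -[LHS]compm1 -[RHS]compm1 -(sK i).2.
by have := congr1 (fun a => a ∘ psi' i) (hk i); rewrite !compA.
Qed.

Lemma coproduct_unique (I : smallset) (X : I -> C) S S'
    (inj : forall i, hom (X i) S) (inj' : forall i, hom (X i) S') :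
  is_coproduct inj -> is_coproduct inj' ->
  exists (phi : hom S S') (phi' : hom S' S),
    [/\ phi' ∘ phi = idm _, phi ∘ phi' = idm _,
      forall i, phi ∘ inj i = inj' i & forall i, phi' ∘ inj' i = inj i].
Proof.
move=> cop cop'.
have [phi phiP] := coproduct_copair inj' cop.
have [phi' phi'P] := coproduct_copair inj cop'.
exists phi, phi'; split=> //.
  by apply: (coproduct_joint_epi cop) => i; rewrite -compA phiP phi'P comp1m.
by apply: (coproduct_joint_epi cop') => i; rewrite -compA phi'P phiP comp1m.
Qed.

End Coproduct.

(** Eckmann-Hilton: the image under [F] of the coin [c (inj true) (inj false)]
defines an idempotent and commutative operation [m] on the morphisms out of
[F X]. It commutes with [d], because precomposition is a midpoint homomorphism,
and this forces [m = d]. *)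
Lemma functor_midpoint (C D : markov) (c : coinflip C) (d : coinflip D)
    (F : functor C D) (X S : C) (inj : bool -> hom X S) :
  is_coproduct inj -> is_coproduct (fun b => fmap F (inj b)) ->
  forall Y, midpoint_hom (c X Y) (d (F X) (F Y)) (@fmap _ _ F X Y).
Proof.
move=> cop Fcop Y.
have [pair pairP] : {pair : forall Z, hom (F X) Z -> hom (F X) Z -> hom (F S) Z &
    forall Z a b, pair Z a b ∘ fmap F (inj true) = a /\
                  pair Z a b ∘ fmap F (inj false) = b}.
  pose pair Z (a b : hom (F X) Z) :=
    sval (cid (coproduct_copair (fun t : bool => if t then a else b) Fcop)).
  exists pair => Z a b; rewrite /pair; case: cid => h hP /=.
  by split; [exact: (hP true)|exact: (hP false)].
have pairE Z (h k : hom (F S) Z) : h ∘ fmap F (inj true) = k ∘ fmap F (inj true) ->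
    h ∘ fmap F (inj false) = k ∘ fmap F (inj false) -> h = k.
  by move=> h1 h0; apply: (coproduct_joint_epi Fcop) => -[].
pose coin := c X S (inj true) (inj false).
pose m Z (a b : hom (F X) Z) := pair Z a b ∘ fmap F coin.
have m_idem Z a : m Z a a = a.
  have [del2 delP] := coproduct_copair (fun _ : bool => idm X) cop.
  have -> : m Z a a = a ∘ fmap F del2 ∘ fmap F coin.
    rewrite /m; congr (_ ∘ _); apply: pairE.
      by rewrite (pairP _ _ _).1 -compA -fmap_comp delP fmap1 compm1.
    by rewrite (pairP _ _ _).2 -compA -fmap_comp delP fmap1 compm1.
  rewrite -compA -fmap_comp /coin (coin_post c).
  by rewrite !delP mid_idem fmap1 compm1.
have m_comm Z a b : m Z a b = m Z b a.
  have [sw swP] := coproduct_copair (fun t : bool => inj (~~ t)) cop.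
  have -> : m Z a b = pair Z b a ∘ fmap F sw ∘ fmap F coin.
    rewrite /m; congr (_ ∘ _); apply: pairE.
      by rewrite (pairP _ _ _).1 -compA -fmap_comp swP (pairP _ _ _).2.
    by rewrite (pairP _ _ _).2 -compA -fmap_comp swP (pairP _ _ _).1.
  by rewrite -compA -fmap_comp /coin (coin_post c) !swP /= mid_comm.
(* Midpoints commute with copairing, which turns [coin_pre] into interchange. *)
have m_mid Z a b a' b' : m Z (d _ _ a a') (d _ _ b b') = d _ _ (m Z a b) (m Z a' b').
  rewrite /m -(coin_pre d); congr (_ ∘ _); apply: pairE.
    by rewrite (pairP _ _ _).1 (coin_pre d) !(pairP _ _ _).1.
  by rewrite (pairP _ _ _).2 (coin_pre d) !(pairP _ _ _).2.
have mE Z a b : m Z a b = d _ _ a b.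
  rewrite -[LHS](mid_idem (d _ _)) {2}m_comm -m_mid.
  by rewrite (mid_comm (d _ _) b) m_idem.
move=> f g /=; have [fg fgP] := coproduct_copair (fun t : bool => if t then f else g) cop.
have -> : c X Y f g = fg ∘ coin.
  by rewrite /coin (coin_post c) (fgP true) (fgP false).
rewrite -mE fmap_comp /m; congr (_ ∘ _).
apply: pairE.
  by rewrite (pairP _ _ _).1 -fmap_comp fgP.
by rewrite (pairP _ _ _).2 -fmap_comp fgP.
Qed.

Section Distributive.
Variables (small : smallset -> Prop) (D : markov).
Hypothesis distD : distributive small D.

Lemma det_coproduct_incl (I : smallset) (X : I -> detcat D) S (inj : forall i, hom (X i) S) :
  small I -> is_coproduct inj -> is_coproduct (C := D) (fun i => sval (inj i)).
Proof. by move=> sI; case: distD => _ + _; exact. Qed.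

Lemma det_coproduct_tensl (A : D) (I : smallset) (X : I -> detcat D) S
    (inj : forall i, hom (X i) S) : small I -> is_coproduct inj ->
  is_coproduct (C := D) (fun i => idm A ⊠ sval (inj i)).
Proof.
move=> sI cop; case: distD => _ _ /(_ A I X S inj sI cop).
exact: (det_coproduct_incl sI).
Qed.

Lemma swap_iso (X Y : D) : is_iso (swap X Y).
Proof. by exists (swap Y X); rewrite !swapK. Qed.

Lemma det_coproduct_tensr (A : D) (I : smallset) (X : I -> detcat D) S
    (inj : forall i, hom (X i) S) : small I -> is_coproduct inj ->
  is_coproduct (C := D) (fun i => sval (inj i) ⊠ idm A).
Proof.
move=> sI cop; have := @det_coproduct_tensl A I X S inj sI cop.
move=> /(coproduct_iso (swap_iso A S) (fun i => swap_iso (X i : D) A)).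
by congr is_coproduct; apply: functional_extensionality_dep => i; rewrite [RHS]swap_conj.
Qed.

Lemma det_coproduct_tens (I J : smallset) (X : I -> detcat D) (Y : J -> detcat D) S T
    (inj : forall i, hom (X i) S) (inj' : forall j, hom (Y j) T) :
  small I -> small J -> is_coproduct inj -> is_coproduct inj' ->
  is_coproduct (C := D) (fun z : I * J => sval (inj z.1) ⊠ sval (inj' z.2)).
Proof.
move=> sI sJ copX copY; apply: is_coproductP => Z.
  move=> f.
  have [h hP] := dep_choice (fun j => coproduct_copair (fun i => f (i, j))
    (@det_coproduct_tensr (Y j) _ _ _ _ sI copX)).
  have [k kP] := coproduct_copair h (@det_coproduct_tensl S _ _ _ _ sJ copY).
  by exists k => -[i j] /=; rewrite tens_split compA kP hP.
move=> h k hk; apply: (coproduct_joint_epi (@det_coproduct_tensl S _ _ _ _ sJ copY)) => j.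
apply: (coproduct_joint_epi (@det_coproduct_tensr (Y j) _ _ _ _ sI copX)) => i.
by rewrite -!compA -!tens_split; exact: (hk (i, j)).
Qed.

(** The comparison with a coproduct of deterministic morphisms is invertible, and
the inverse of a deterministic isomorphism is deterministic. *)
Lemma det_coproduct_reflect (I : smallset) (X : I -> detcat D) S (inj : forall i, hom (X i) S) :
  small I -> is_coproduct (C := D) (fun i => sval (inj i)) -> is_coproduct inj.
Proof.
move=> sI cop; case: distD => /(_ I X sI)[T [inj' cop']] _ _.
have [phi [phi' [p1 p2 p3 p4]]] := coproduct_unique (det_coproduct_incl sI cop') cop.
have [psi psiP] := coproduct_copair inj cop'.
have phiE : phi = sval psi.
  apply: (coproduct_joint_epi (det_coproduct_incl sI cop')) => i.
  by rewrite p3 -psiP.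
have dphi : deterministic phi by rewrite phiE; exact: proj2_sig.
have dphi' : deterministic phi' by exact: det_inverse dphi.
have iphi : is_iso (psi : hom (T : detcat D) S).
  by exists (exist _ phi' dphi'); split; apply: det_ext; rewrite /= -phiE.
have := coproduct_iso iphi (fun i => is_iso_id (X i)) cop'.
by congr is_coproduct; apply: functional_extensionality_dep => i; rewrite compm1 psiP.
Qed.

Hypothesis small_bool : small bool.

Lemma binary_det_coproduct (X : D) : exists (S : detcat D) (inj : bool -> hom (X : detcat D) S),
  is_coproduct inj.
Proof. by case: distD => /(_ bool (fun=> X : detcat D) small_bool). Qed.

Definition tens_functor (A : D) : functor D D.
Proof.
refine (@Functor D D (fun X => A ⊗ X) (fun X Y f => idm A ⊠ f) _ _).
- by move=> X; exact: tens1.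
- by move=> X Y Z g f; rewrite -tens_comp comp1m.
Defined.

Variable c : coinflip D.

(** Tensoring with an object preserves the coproduct of two copies of [Y], so
[functor_midpoint] applies to it. *)
Lemma tens_midpointr (X X' Y Y' : D) (h : hom X X') :
  midpoint_hom (c Y Y') (c (X ⊗ Y) (X' ⊗ Y')) (fun f => h ⊠ f).
Proof.
have [S [inj cop]] := binary_det_coproduct Y.
move=> f g /=.
rewrite (tens_split' h (c _ _ f g)) (tens_split' h f) (tens_split' h g) -(coin_post c).
congr (_ ∘ _).
exact: (@functor_midpoint D D c c (tens_functor X) Y S (fun b => sval (inj b))
  (det_coproduct_incl small_bool cop) (@det_coproduct_tensl X _ _ _ _ small_bool cop)).
Qed.

Lemma tens_midpointl (X X' Y Y' : D) (h : hom X X') :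
  midpoint_hom (c Y Y') (c (Y ⊗ X) (Y' ⊗ X')) (fun f => f ⊠ h).
Proof.
move=> f g /=; rewrite (swap_conj (c _ _ f g)) (swap_conj f) (swap_conj g) tens_midpointr.
by rewrite (coin_post c) (coin_pre c).
Qed.

End Distributive.

(** * Full subcategories of the Kleisli category *)

Section FreeDist.
Variables (R : realType) (X : smallset) (A : Type) (m : midpoint_algebra A).
Hypothesis itA : iterable m.

Lemma dist_free_unique (G H : dist R X -> A) :
  midpoint_hom (dist_mid R X) m G -> midpoint_hom (dist_mid R X) m H ->
  (forall x, G (dret R x) = H (dret R x)) -> G = H.
Proof.
move=> hG hH GH; apply/funext => p; have [x0 _] := dist_inh p.
exact: (congr1 (@^~ p) (dist_hom_unique x0 itA hG hH GH)).
Qed.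

Lemma dist_free_exists (f : X -> A) :
  exists2 G, midpoint_hom (dist_mid R X) m G & forall x, G (dret R x) = f x.
Proof.
have [[x0]|X0] := pselect (inhabited X); first exact: dist_hom_exists.
have absurd (p : dist R X) : False by have [x _] := dist_inh p; apply: X0.
by exists (fun p => match absurd p with end) => [p|x]; [case: (absurd p)|case: X0].
Qed.

End FreeDist.

Section Dirac.
Local Open Scope ring_scope.
Variable R : realType.

Lemma dret_inj (X : smallset) : injective (@dret R X).
Proof.
move=> x y xy; apply: contrapT => ne.
have := dret_id R y; rewrite -xy dret_neq//.
by move/eqP; rewrite eq_sym oner_eq0.
Qed.

Lemma kfun_inj (X Y : smallset) (phi psi : X -> Y) :
  kfun R phi = kfun R psi -> phi = psi.
Proof. by move=> e; apply/funext => x; apply: dret_inj; exact: (congr1 (@^~ x) e). Qed.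

Lemma kcomp_kfun (X Y Z : smallset) (g : kernel R Y Z) (phi : X -> Y) :
  kcomp g (kfun R phi) = g \o phi.
Proof. by apply/funext => x; exact: dbind_ret. Qed.

Lemma dist_dirac (X : smallset) (p : dist R X) (x : X) :
  (forall y, y <> x -> p y = 0) -> p = dret R x.
Proof.
move=> p0; apply: dist_ext => y; have [->|/eqP yx] := eqVneq (y : {classic X}) x.
  rewrite dret_id; apply: EFin_inj; rewrite -(pmf_sum1 p).
  rewrite (@esum_point R {classic X} x) => [//|z|z /p0 ->//].
  by rewrite lee_fin pmf_ge0.
by rewrite p0// dret_neq// => xy; apply: yx.
Qed.

(** Independence of two copies of one sample forces every probability to be 0
or 1. *)
Lemma dist_idempotent_dirac (X : smallset) (p : dist R X) :
  (forall x y, p x * p y = if `[< x = y >] then p x else 0) ->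
  exists x, p = dret R x.
Proof.
move=> pp; have [x px] := dist_inh p; exists x; apply: dist_dirac => y yx.
have := pp y x; rewrite asboolF// => /eqP; rewrite mulf_eq0 => /orP[/eqP//|].
by rewrite gt_eqF.
Qed.

End Dirac.

(** A full embedding of [C] into the Kleisli category of countably supported
distributions whose image contains a one-point set and is closed under products
and small disjoint unions. The comparison of products is a bijection and not an
equality, so that it applies to categories whose objects carry more structure
than a set. *)
Record kleisli_embedding (R : realType) (small : smallset -> Prop) (C : markov) :=
  KleisliEmbedding {
  eob : C -> smallset;
  ehom : forall X Y : C, hom X Y -> kernel R (eob X) (eob Y);
  ehom_inj : forall X Y, injective (@ehom X Y);
  ehom_surj : forall X Y (k : kernel R (eob X) (eob Y)), exists f : hom X Y, ehom f = k;
  ehom_id : forall X, ehom (idm X) = kfun R id;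
  ehom_comp : forall X Y Z (g : hom Y Z) (f : hom X Y),
    ehom (g ∘ f) = kcomp (ehom g) (ehom f);
  eunit : eob unitob;
  eunit_unique : forall x : eob unitob, x = eunit;
  epair : forall X Y, eob X * eob Y -> eob (X ⊗ Y);
  eproj : forall X Y, eob (X ⊗ Y) -> eob X * eob Y;
  epairK : forall X Y, cancel (@epair X Y) (@eproj X Y);
  eprojK : forall X Y, cancel (@eproj X Y) (@epair X Y);
  ehom_tens : forall X X' Y Y' (f : hom X X') (g : hom Y Y') z w,
    ehom (f ⊠ g) z w
    = (ehom f (eproj z).1 (eproj w).1 * ehom g (eproj z).2 (eproj w).2)%R;
  ehom_copy : forall X, ehom (copy X) = kfun R (fun x => epair (x, x));
  eob_small : forall X, small (eob X);
  esum_exists : forall (J : smallset) (X : J -> C), small J ->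
    exists (S : C) (sigma : {j : J & eob (X j)} -> eob S) tau,
      cancel sigma tau /\ cancel tau sigma
}.

Arguments eob {R small C} k X : rename.
Arguments ehom {R small C} k {X Y} f : rename.
Arguments ehom_inj {R small C} k {X Y} [x1 x2] : rename.
Arguments ehom_surj {R small C} k {X Y} _ : rename.
Arguments ehom_id {R small C} k X : rename.
Arguments eunit {R small C} k : rename.
Arguments epair {R small C k X Y} _ : rename.
Arguments eproj {R small C k X Y} _ : rename.
Arguments esum_exists {R small C} k [J] X _ : rename.

Section Embedding.
Local Open Scope ring_scope.
Variables (R : realType) (small : smallset -> Prop) (C : markov).
Variable E : kleisli_embedding R small C.
Implicit Types X Y Z : C.

Lemma hom_of_kernel X Y : exists inv : kernel R (eob E X) (eob E Y) -> hom X Y,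
  cancel inv (@ehom _ _ _ E X Y).
Proof. by have [inv invK] := choice (@ehom_surj _ _ _ E X Y); exists inv. Qed.

Definition khom X Y : kernel R (eob E X) (eob E Y) -> hom X Y :=
  sval (cid (hom_of_kernel X Y)).

Lemma khomK X Y (k : kernel R (eob E X) (eob E Y)) : ehom E (khom k) = k.
Proof. by rewrite /khom; case: cid. Qed.

Lemma ehom_tens_fun X X' Y Y' (f : hom X X') (g : hom Y Y') phi psi :
  ehom E f = kfun R phi -> ehom E g = kfun R psi ->
  ehom E (f ⊠ g) = kfun R (fun z => epair (phi (eproj z).1, psi (eproj z).2)).
Proof.
move=> fE gE; apply: kernel_ext => z w; rewrite ehom_tens fE gE.
rewrite /kfun /= -natrM mulnb -asbool_and; congr (_ %:R); congr nat_of_bool.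
apply: asbool_equiv_eq; split=> [[e1 e2]|<-]; last by rewrite epairK.
by rewrite e1 e2 -surjective_pairing eprojK.
Qed.

Lemma deterministicP X Y (f : hom X Y) :
  deterministic f <-> exists phi, ehom E f = kfun R phi.
Proof.
split=> [df|[phi fE]].
  suff /choice[phi phiP] : forall x, exists y, ehom E f x = dret R y.
    by exists phi; apply/funext => x; exact: phiP.
  move=> x; apply: dist_idempotent_dirac => y z.
  have e : ehom E f x y * ehom E f x z
      = dbind (ehom E f x) (kfun R (fun t => epair (t, t))) (epair (y, z)).
    transitivity (ehom E (f ⊠ f) (epair (x, x)) (epair (y, z))).
      by rewrite ehom_tens !epairK.
    have := congr1 (fun h => ehom E h x (epair (y, z))) df.
    by rewrite !ehom_comp !ehom_copy kcomp_kfun => /esym.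
  apply: EFin_inj; rewrite e dbindE; case: asboolP => [->|yz].
    rewrite (@esum_point R {classic _} z) => [|t|t tz].
    - by rewrite /kfun dret_id mulr1.
    - by rewrite lee_fin mulr_ge0// pmf_ge0.
    - rewrite /kfun dret_neq ?mulr0// => /(congr1 eproj).
      by rewrite !epairK => -[].
  rewrite esum1// => t _; rewrite /kfun dret_neq ?mulr0// => /(congr1 eproj).
  by rewrite !epairK => -[ty tz]; apply: yz; rewrite -ty.
apply: (ehom_inj E); rewrite !ehom_comp !ehom_copy (ehom_tens_fun fE fE) fE.
by rewrite !kcomp_fun; congr kfun; apply/funext => x /=; rewrite epairK.
Qed.

(** A cocone of functions exhibiting its vertex as a disjoint union. It is a
coproduct in [C] and in [detcat C]; conversely every small coproduct of
[detcat C] has this form, which is how the preservation properties are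
transferred. *)
Definition bijective_cocone (J : smallset) (X : J -> C) S (inj : forall j, hom (X j) S)
    (iota : forall j, eob E (X j) -> eob E S) :=
  (forall j, ehom E (inj j) = kfun R (iota j)) /\
  exists2 tau : eob E S -> {j : J & eob E (X j)},
    forall j x, tau (iota j x) = existT _ j x &
    forall s, iota (tag (tau s)) (tagged (tau s)) = s.

Section Cocone.
Variables (J : smallset) (X : J -> C) (S : C) (inj : forall j, hom (X j) S).
Variable iota : forall j, eob E (X j) -> eob E S.
Hypothesis bij : bijective_cocone inj iota.

Lemma bijective_cocone_copair Y (f : forall j, hom (X j) Y) :
  exists2 h : hom S Y, forall j, h ∘ inj j = f j &
    (forall j, deterministic (f j)) -> deterministic h.
Proof.
case: bij => injE [tau iotaK tauK].
exists (khom (fun s => ehom E (f (tag (tau s))) (tagged (tau s)))).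
  move=> j; apply: (ehom_inj E); rewrite ehom_comp khomK injE kcomp_kfun.
  by apply/funext => x /=; rewrite iotaK.
move=> df; have [phi phiP] := dep_choice (fun j => iffLR (deterministicP (f j)) (df j)).
apply/deterministicP; exists (fun s => phi (tag (tau s)) (tagged (tau s))).
by rewrite khomK; apply/funext => s; rewrite phiP.
Qed.

Lemma bijective_cocone_epi Y (h k : hom S Y) :
  (forall j, h ∘ inj j = k ∘ inj j) -> h = k.
Proof.
case: bij => injE [tau iotaK tauK] hk; apply: (ehom_inj E).
apply/funext => s; rewrite -(tauK s).
have := congr1 (fun g => ehom E g (tagged (tau s))) (hk (tag (tau s))).
by rewrite !ehom_comp !injE !kcomp_kfun.
Qed.

Lemma bijective_cocone_coproduct : is_coproduct inj.
Proof.
apply: is_coproductP; last exact: bijective_cocone_epi.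
by move=> Y f; have [h hP _] := bijective_cocone_copair f; exists h.
Qed.

End Cocone.

Lemma bijective_cocone_detcat (J : smallset) (X : J -> detcat C) (S : detcat C)
    (inj : forall j, hom (X j) S) iota :
  bijective_cocone (fun j => sval (inj j)) iota -> is_coproduct inj.
Proof.
move=> bij; apply: is_coproductP => Y.
  move=> f; have [h hP dh] := bijective_cocone_copair bij (fun j => sval (f j)).
  exists (exist _ h (dh (fun j => proj2_sig (f j)))) => j.
  by apply: det_ext; rewrite /= hP.
move=> h k hk; apply: det_ext; apply: (bijective_cocone_epi bij) => j.
exact: (congr1 sval (hk j)).
Qed.

Lemma bijective_cocone_exists (J : smallset) (X : J -> detcat C) : small J ->
  exists (S : detcat C) (inj : forall j, hom (X j) S) iota,
    bijective_cocone (fun j => sval (inj j)) iota.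
Proof.
move=> sJ; have [S [sigma [tau [sK tK]]]] := esum_exists E X sJ.
pose iota j x := sigma (existT _ j x).
have dinj j : deterministic (khom (kfun R (iota j))).
  by apply/deterministicP; exists (iota j); rewrite khomK.
exists S, (fun j => exist _ _ (dinj j)), iota; split=> [j|]; first by rewrite khomK.
by exists tau => [j x|s]; [rewrite sK|rewrite /iota -sigT_eta tK].
Qed.

Lemma det_coproduct_bijective (J : smallset) (X : J -> detcat C) (S : detcat C)
    (inj : forall j, hom (X j) S) : small J -> is_coproduct inj ->
  exists iota, bijective_cocone (fun j => sval (inj j)) iota.
Proof.
move=> sJ cop; have [T [inj' [iota [injE [tau iotaK tauK]]]]] := bijective_cocone_exists X sJ.
have bij : bijective_cocone (fun j => sval (inj' j)) iota by split=> //; exists tau.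
have [phi [phi' [pK Kp phiP phi'P]]] := coproduct_unique (bijective_cocone_detcat bij) cop.
have [f fE] := iffLR (deterministicP _) (proj2_sig phi).
have [g gE] := iffLR (deterministicP _) (proj2_sig phi').
have gf : cancel f g.
  move=> t; have := congr1 (fun h => ehom E (sval h)) pK.
  rewrite /= ehom_comp ehom_id gE fE kcomp_fun => /kfun_inj.
  by move/(congr1 (@^~ t)).
have fg : cancel g f.
  move=> t; have := congr1 (fun h => ehom E (sval h)) Kp.
  rewrite /= ehom_comp ehom_id gE fE kcomp_fun => /kfun_inj.
  by move/(congr1 (@^~ t)).
exists (fun j => f \o iota j); split.
  by move=> j; rewrite -phiP /= ehom_comp fE injE kcomp_fun.
by exists (tau \o g) => [j x|s] /=; [rewrite gf iotaK|rewrite tauK fg].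
Qed.

Lemma tens_bijective_cocone A (J : smallset) (X : J -> C) S (inj : forall j, hom (X j) S)
    iota : bijective_cocone inj iota ->
  bijective_cocone (fun j => idm A ⊠ inj j)
    (fun j z => epair ((eproj z).1, iota j (eproj z).2)).
Proof.
case=> injE [tau iotaK tauK]; split.
  by move=> j; rewrite (ehom_tens_fun (ehom_id E A) (injE j)).
exists (fun w => existT (fun j => eob E (A ⊗ X j)) (tag (tau (eproj w).2))
  (epair ((eproj w).1, tagged (tau (eproj w).2)))).
  by move=> j z; rewrite epairK /= iotaK /= -surjective_pairing eprojK.
by move=> w /=; rewrite epairK /= tauK -surjective_pairing eprojK.
Qed.

Lemma embedding_distributive : distributive small C.
Proof.
split.
- move=> J X sJ; have [S [inj [iota bij]]] := bijective_cocone_exists X sJ.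
  by exists S, inj; exact: bijective_cocone_detcat bij.
- move=> J X S inj sJ /(det_coproduct_bijective sJ)[iota bij].
  exact: bijective_cocone_coproduct bij.
- move=> A J X S inj sJ /(det_coproduct_bijective sJ)[iota bij].
  apply: bijective_cocone_detcat.
  exact: (tens_bijective_cocone A bij).
Qed.

Definition hom_mid X Y : midpoint_algebra (hom X Y).
Proof.
apply: (@MidpointAlgebra _ (fun f g => khom (fun x => dmid (ehom E f x) (ehom E g x)))).
- move=> f; apply: (ehom_inj E); rewrite khomK; apply/funext => x.
  exact: (mid_idem (dist_mid _ _)).
- move=> f g; congr khom; apply/funext => x; exact: (mid_comm (dist_mid _ _)).
- move=> f g h k; congr khom; apply/funext => x; rewrite !khomK.
  exact: (mid_medial (dist_mid _ _)).
Defined.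

Lemma ehom_mid X Y (f g : hom X Y) x :
  ehom E (hom_mid X Y f g) x = dmid (ehom E f x) (ehom E g x).
Proof. by rewrite khomK. Qed.

Definition embedding_coinflip : coinflip C.
Proof.
apply: (@Coinflip C hom_mid).
- move=> X Y Z g f f'; apply: (ehom_inj E); apply/funext => x.
  by rewrite ehom_mid !ehom_comp /kcomp ehom_mid dbind_mid.
- move=> X Y Z f g g'; apply: (ehom_inj E); apply/funext => x.
  rewrite ehom_mid !ehom_comp /kcomp -dbind_mid_fun; congr dbind.
  by apply/funext => y; rewrite ehom_mid.
Defined.

Lemma embedding_iterable : externally_iterable embedding_coinflip.
Proof.
move=> X Y S s.
have [u [uP uU]] := @dist_iterable R (eob E Y) (S * eob E X)%type
  (fun z => (((s z.1).1, z.2), ehom E (s z.1).2 z.2)).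
exists (fun z => khom (fun x => u (z, x))); split.
  move=> z; apply: (ehom_inj E); apply/funext => x.
  by rewrite khomK ehom_mid khomK uP.
move=> v vP; apply/funext => z; apply: (ehom_inj E); rewrite khomK.
apply/funext => x; have -> : u = fun z => ehom E (v z.1) z.2 => //.
by apply: uU => -[w y] /=; rewrite {1}vP ehom_mid.
Qed.

Lemma embedding_dist_iter_coinflip : dist_iter_coinflip small C.
Proof.
split; first exact: embedding_distributive.
by exists embedding_coinflip; exact: embedding_iterable.
Qed.

Definition point X (x : eob E X) : hom unitob X := khom (fun=> dret R x).

Lemma ehom_point X (x : eob E X) : ehom E (point x) = kfun R (fun=> x).
Proof. exact: khomK. Qed.

Lemma point_det X (x : eob E X) : deterministic (point x).
Proof. by apply/deterministicP; exists (fun=> x); exact: ehom_point. Qed.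

Definition dpoint X (x : eob E X) : hom (unitob : detcat C) X :=
  exist _ (point x) (point_det x).

Lemma point_coproduct X : is_coproduct (@dpoint X).
Proof.
apply: (@bijective_cocone_detcat _ _ _ _ (fun x _ => x)); split.
  by move=> x; exact: ehom_point.
exists (fun x => existT (fun=> eob E unitob) x (eunit E)) => // x y.
by rewrite (eunit_unique y).
Qed.

Lemma point_tens X Y (x : eob E X) (y : eob E Y) :
  (point x ⊠ point y) ∘ luniti unitob = point (epair (x, y)).
Proof.
apply: (ehom_inj E); rewrite ehom_comp.
rewrite (ehom_tens_fun (ehom_point x) (ehom_point y)) ehom_point.
have -> : ehom E (luniti unitob) = kfun R (fun=> epair (eunit E, eunit E)).
  apply/funext => z; apply: dist_dirac => w; case.
  by rewrite -(eprojK w) (surjective_pairing (eproj w)) (eunit_unique (_.1)) (eunit_unique (_.2)).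
by rewrite kcomp_fun.
Qed.

Lemma point_cocone (J : smallset) (X : J -> C) S (inj : forall j, hom (X j) S) iota j x :
  bijective_cocone inj iota -> inj j ∘ point x = point (iota j x).
Proof.
case=> injE _; apply: (ehom_inj E).
by rewrite ehom_comp injE !ehom_point kcomp_fun.
Qed.

Lemma points_mid_hom X (A : Type) (m : midpoint_algebra A) (G : hom unitob X -> A) :
  midpoint_hom (embedding_coinflip unitob X) m G ->
  midpoint_hom (dist_mid R _) m (fun p => G (khom (fun=> p))).
Proof.
move=> hG p q; rewrite -hG; congr G; apply: (ehom_inj E).
by rewrite khomK; apply/funext => x; rewrite ehom_mid !khomK.
Qed.

Lemma khom_ehom_unit X (f : hom unitob X) : khom (fun=> ehom E f (eunit E)) = f.
Proof.
apply: (ehom_inj E); rewrite khomK; apply/funext => x.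
by rewrite (eunit_unique x).
Qed.

(** A morphism out of the unit is a distribution on points, so freeness of
distributions carries over to [hom unitob X]. *)
Lemma point_free_unique X (A : Type) (m : midpoint_algebra A)
    (G H : hom unitob X -> A) : iterable m ->
  midpoint_hom (embedding_coinflip unitob X) m G ->
  midpoint_hom (embedding_coinflip unitob X) m H ->
  (forall x, G (point x) = H (point x)) -> G = H.
Proof.
move=> itA hG hH GH; apply/funext => f; rewrite -(khom_ehom_unit f).
apply: (congr1 (@^~ (ehom E f (eunit E)))
  (dist_free_unique itA (points_mid_hom hG) (points_mid_hom hH) _)).
exact: GH.
Qed.

Lemma point_free_exists X (A : Type) (m : midpoint_algebra A) (f : eob E X -> A) :
  iterable m ->
  exists2 G : hom unitob X -> A,
    midpoint_hom (embedding_coinflip unitob X) m G & forall x, G (point x) = f x.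
Proof.
move=> itA; have [G hG Gf] := dist_free_exists R itA f.
exists (fun h => G (ehom E h (eunit E))) => [h k|x]; first by rewrite ehom_mid hG.
by rewrite ehom_point Gf.
Qed.

End Embedding.

(** * Initiality *)

Section MarkovFunctor.
Variables (C D : markov) (F : markov_functor C D).

Lemma mui_nat (X X' Y Y' : C) (f : hom X X') (g : hom Y Y') :
  mui F X' Y' ∘ fmap F (f ⊠ g) = (fmap F f ⊠ fmap F g) ∘ mui F X Y.
Proof.
rewrite -[LHS]compm1 -muiK compA -(compA (mui F X' Y')) -mu_nat compA muK.
by rewrite comp1m.
Qed.

Lemma fmap_det (X Y : C) (f : hom X Y) : deterministic f -> deterministic (fmap F f).
Proof.
rewrite /deterministic => df.
by rewrite -!fmap_copy -compA -fmap_comp df fmap_comp !compA mui_nat.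
Qed.

Lemma mu0_det : deterministic (mu0 F).
Proof. by apply: det_inverse (del_det (mu0i F)); [exact: mu0iK|exact: mu0K]. Qed.

Lemma mu0_iso : is_iso (mu0 F).
Proof. by exists (mu0i F); rewrite mu0K mu0iK. Qed.

Lemma mu_unit : mu F unitob unitob ∘ (mu0 F ⊠ mu0 F)
  = fmap F (luniti unitob) ∘ mu0 F ∘ lunit unitob.
Proof.
have e := mu_lunit F unitob.
rewrite -[LHS]comp1m -fmap1 -lunitK fmap_comp -!compA; congr (_ ∘ _).
rewrite [mu0 F ⊠ _]tens_split' !compA e.
exact: lunit_nat.
Qed.

End MarkovFunctor.

Section Initiality.
Variables (R : realType) (small : smallset -> Prop) (C : markov).
Variable E : kleisli_embedding R small C.
Hypothesis small_bool : small bool.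
Variables (D : markov) (d : coinflip D).
Hypothesis distD : distributive small D.
Hypothesis itD : externally_iterable d.

Let distC := embedding_distributive E.

Section Uniqueness.
Variable F : markov_functor C D.
Hypothesis copF : preserves_coproducts small F.

Lemma point_coproduct_incl (X : C) : is_coproduct (@point _ _ _ E X).
Proof. exact: (det_coproduct_incl distC (eob_small E X) (@point_coproduct _ _ _ E X)). Qed.

(** The points of [F X] induced by points of [X], with the unit constraint of [F]
absorbed. *)
Definition fpoint (X : C) (p : hom unitob X) : hom unitob (F X) := fmap F p ∘ mu0 F.

Lemma fpoint_comp (X Y : C) (f : hom X Y) (p : hom unitob X) :
  fmap F f ∘ fpoint p = fpoint (f ∘ p).
Proof. by rewrite /fpoint compA -fmap_comp. Qed.

Lemma fpoint_det (X : C) (p : hom unitob X) : deterministic p -> deterministic (fpoint p).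
Proof. by move=> dp; apply: det_comp (mu0_det F); exact: fmap_det. Qed.

(** [F] preserves the coproduct of two copies of the unit, hence coin flips. *)
Lemma fpoint_mid (X : C) :
  midpoint_hom (embedding_coinflip E unitob X) (d unitob (F X)) (@fpoint X).
Proof.
have [S [inj cop]] := binary_det_coproduct distC small_bool unitob.
have copC := det_coproduct_incl distC small_bool cop.
move=> p q; rewrite /fpoint -(coin_pre d); congr (_ ∘ _).
exact: (functor_midpoint (embedding_coinflip E) d copC (copF small_bool copC)).
Qed.

Definition dfpoint (X : C) (x : eob E X) : hom (unitob : detcat D) (F X) :=
  exist _ (fpoint (point x)) (fpoint_det (point_det x)).

Lemma fpoint_coproduct (X : C) : is_coproduct (@dfpoint X).
Proof.
apply: (det_coproduct_reflect distD (eob_small E X)).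
have := copF (eob_small E X) (@point_coproduct_incl X).
move=> /(coproduct_iso (is_iso_id _) (fun _ => mu0_iso F)).
by congr is_coproduct; apply: functional_extensionality_dep => x; rewrite comp1m.
Qed.

Lemma fpoint_coproduct_incl (X : C) : is_coproduct (fun x : eob E X => fpoint (point x)).
Proof. exact: (det_coproduct_incl distD (eob_small E X) (@fpoint_coproduct X)). Qed.

Lemma fpoint_tens_coproduct (X Y : C) :
  is_coproduct (fun z : eob E X * eob E Y => fpoint (point z.1) ⊠ fpoint (point z.2)).
Proof.
exact: (det_coproduct_tens distD (eob_small E X) (eob_small E Y)
  (@fpoint_coproduct X) (@fpoint_coproduct Y)).
Qed.

Lemma mu_fpoint (X Y : C) (p : hom unitob X) (q : hom unitob Y) :
  mu F X Y ∘ (fpoint p ⊠ fpoint q) = fpoint ((p ⊠ q) ∘ luniti unitob) ∘ lunit unitob.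
Proof.
rewrite /fpoint tens_comp compA mu_nat -compA mu_unit !compA.
by rewrite -fmap_comp.
Qed.

End Uniqueness.

(** The equation is imposed on points, where it defines [theta]; it extends to all
[p] since both sides are midpoint homomorphisms in [p]. *)
Lemma comparison_exists (F G : markov_functor C D) :
  preserves_coproducts small F -> preserves_coproducts small G ->
  exists theta : forall X : C, hom (F X) (G X),
    forall X (p : hom unitob X), theta X ∘ fpoint F p = fpoint G p.
Proof.
move=> copF copG.
have [theta thetaP] := dep_choice (fun X : C => coproduct_copair
  (fun x : eob E X => fpoint G (point x)) (@fpoint_coproduct_incl _ copF X)).
exists theta => X p.
apply: (congr1 (@^~ p) (point_free_unique (m := d unitob (G X))
  (G := fun p => theta X ∘ fpoint F p) _ _ (fpoint_mid copG (X := X)) (thetaP X))).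
- exact: itD.
- by move=> a b; rewrite (fpoint_mid copF) (coin_post d).
Qed.

(** Naturality, invertibility and monoidality are checked after composition with
the jointly epic families of points. There, a monoidal transformation is forced
to satisfy the equation of [comparison_exists]. *)
Lemma comparison_unique (F G : markov_functor C D) :
  preserves_coproducts small F -> preserves_coproducts small G ->
  exists! theta : forall X : C, hom (F X) (G X), monoidal_natiso theta.
Proof.
move=> copF copG.
have [theta thetaP] := comparison_exists copF copG.
have [theta' theta'P] := comparison_exists copG copF.
exists theta; split; last first.
  move=> eta [nat _ _ unit]; apply: functional_extensionality_dep => X.
  apply: (coproduct_joint_epi (@fpoint_coproduct_incl _ copF X)) => x.
  by rewrite thetaP /fpoint compA nat -compA unit.
split.
- move=> X Y f; apply: (coproduct_joint_epi (@fpoint_coproduct_incl _ copF X)) => x.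
  by rewrite -!compA fpoint_comp !thetaP fpoint_comp.
- move=> X; exists (theta' X); split.
    apply: (coproduct_joint_epi (@fpoint_coproduct_incl _ copF X)) => x.
    by rewrite -compA thetaP theta'P comp1m.
  apply: (coproduct_joint_epi (@fpoint_coproduct_incl _ copG X)) => x.
  by rewrite -compA theta'P thetaP comp1m.
- move=> X Y; apply: (coproduct_joint_epi (@fpoint_tens_coproduct _ copF X Y)) => z.
  rewrite -!compA mu_fpoint -tens_comp !thetaP mu_fpoint.
  by rewrite compA thetaP.
- by have := thetaP unitob (idm unitob); rewrite /fpoint !fmap1 !comp1m.
Qed.

Section Existence.
Variable FO : C -> D.
Variable iota : forall X : C, eob E X -> hom (unitob : detcat D) (FO X).
Hypothesis iotaP : forall X, is_coproduct (@iota X).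
Variable rho : forall X : C, hom unitob X -> hom unitob (FO X).
Hypothesis rho_mid : forall X,
  midpoint_hom (embedding_coinflip E unitob X) (d unitob (FO X)) (@rho X).
Hypothesis rho_point : forall X x, rho (point x) = sval (@iota X x).

Lemma rho_unique (X : C) (Y : D) (g h : hom unitob X -> hom unitob Y) :
  midpoint_hom (embedding_coinflip E unitob X) (d unitob Y) g ->
  midpoint_hom (embedding_coinflip E unitob X) (d unitob Y) h ->
  (forall x : eob E X, g (point x) = h (point x)) -> forall p, g p = h p.
Proof.
move=> hg hh gh p; exact: (congr1 (@^~ p) (point_free_unique (@itD _ _) hg hh gh)).
Qed.

Lemma rho_coproduct (X : C) : is_coproduct (fun x : eob E X => rho (point x)).
Proof.
have := det_coproduct_incl distD (eob_small E X) (@iotaP X).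
by congr is_coproduct; apply: functional_extensionality_dep => x; rewrite rho_point.
Qed.

Lemma rho_epi (X : C) Y (h k : hom (FO X) Y) : (forall p, h ∘ rho p = k ∘ rho p) -> h = k.
Proof. by move=> hk; apply: (coproduct_joint_epi (@rho_coproduct X)) => x. Qed.

Lemma rho_tens_coproduct (X Y : C) :
  is_coproduct (fun z : eob E X * eob E Y => rho (point z.1) ⊠ rho (point z.2)).
Proof.
have := det_coproduct_tens distD (eob_small E X) (eob_small E Y) (@iotaP X) (@iotaP Y).
by congr is_coproduct; apply: functional_extensionality_dep => x; rewrite !rho_point.
Qed.

Lemma rho_tens_epi (X Y : C) Z (h k : hom (FO X ⊗ FO Y) Z) :
  (forall p q, h ∘ (rho p ⊠ rho q) = k ∘ (rho p ⊠ rho q)) -> h = k.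
Proof. by move=> hk; apply: (coproduct_joint_epi (@rho_tens_coproduct X Y)) => z. Qed.

Definition fmap_spec (X Y : C) (f : hom X Y) : {g : hom (FO X) (FO Y) |
  forall p, g ∘ rho p = rho (f ∘ p)}.
Proof.
apply: cid; have [g gP] := coproduct_copair
  (fun x : eob E X => rho (f ∘ point x)) (@rho_coproduct X).
exists g; apply: rho_unique => // a b.
- by rewrite rho_mid (coin_post d).
- by rewrite (coin_post (embedding_coinflip E)) rho_mid.
Qed.

Definition Fmap (X Y : C) (f : hom X Y) := sval (fmap_spec f).

Lemma Fmap_rho (X Y : C) (f : hom X Y) p : Fmap f ∘ rho p = rho (f ∘ p).
Proof. by rewrite /Fmap; case: fmap_spec. Qed.

Definition free_functor : functor C D.
Proof.
refine (@Functor C D FO Fmap _ _).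
- by move=> X; apply: rho_epi => p; rewrite Fmap_rho !comp1m.
- by move=> X Y Z g f; apply: rho_epi => p; rewrite -compA !Fmap_rho compA.
Defined.

(** The formula holds on points by construction and extends to one argument at
a time, since tensoring is a midpoint homomorphism in each variable. *)
Definition mu_spec (X Y : C) : {m : hom (FO X ⊗ FO Y) (FO (X ⊗ Y)) |
  forall p q, m ∘ (rho p ⊠ rho q) = rho ((p ⊠ q) ∘ luniti unitob) ∘ lunit unitob}.
Proof.
apply: cid; have [g gP] := coproduct_copair
  (fun z : eob E X * eob E Y => rho ((point z.1 ⊠ point z.2) ∘ luniti unitob) ∘ lunit unitob)
  (@rho_tens_coproduct X Y).
exists g => p q.
have cancel_lunit Z (a b : hom (unitob ⊗ unitob) Z) :
    a ∘ luniti (unitob : D) = b ∘ luniti unitob -> a = b.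
  by move=> ab; rewrite -[a]compm1 -[b]compm1 -lunitK !compA ab.
apply: cancel_lunit; rewrite -!compA lunitiK compm1.
move: p q; have step (x : eob E X) (q : hom unitob Y) :
    g ∘ ((rho (point x) ⊠ rho q) ∘ luniti unitob)
    = rho ((point x ⊠ q) ∘ luniti unitob) :> hom unitob (FO (X ⊗ Y)).
  move: q; apply: rho_unique => [a b|a b|y].
  - by rewrite rho_mid (tens_midpointr distD small_bool) (coin_pre d) (coin_post d).
  - rewrite (tens_midpointr distC small_bool (embedding_coinflip E)).
    by rewrite (coin_pre (embedding_coinflip E)) rho_mid.
  - by rewrite compA (gP (x, y)) -compA lunitiK compm1.
move=> p q; move: p; apply: rho_unique => [a b|a b|x].
- by rewrite rho_mid (tens_midpointl distD small_bool) (coin_pre d) (coin_post d).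
- rewrite (tens_midpointl distC small_bool (embedding_coinflip E)).
  by rewrite (coin_pre (embedding_coinflip E)) rho_mid.
- exact: step.
Qed.

Definition Fmu (X Y : C) := sval (mu_spec X Y).

Lemma Fmu_rho (X Y : C) p q :
  Fmu X Y ∘ (rho p ⊠ rho q) = rho ((p ⊠ q) ∘ luniti unitob) ∘ lunit unitob.
Proof. by rewrite /Fmu; case: mu_spec. Qed.

Definition mui_spec (X Y : C) : {m : hom (FO (X ⊗ Y)) (FO X ⊗ FO Y) |
  m ∘ Fmu X Y = idm _ /\ Fmu X Y ∘ m = idm _}.
Proof.
apply: cid; have [m mP] := coproduct_copair
  (fun z : eob E (X ⊗ Y) =>
    (rho (point (eproj z).1) ⊠ rho (point (eproj z).2)) ∘ luniti unitob)
  (@rho_coproduct (X ⊗ Y)).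
exists m; split.
  apply: (coproduct_joint_epi (@rho_tens_coproduct X Y)) => -[x y] /=.
  rewrite -compA Fmu_rho point_tens compA mP epairK /= -compA lunitK.
  by rewrite compm1 comp1m.
apply: (coproduct_joint_epi (@rho_coproduct (X ⊗ Y))) => z.
rewrite -compA mP compA Fmu_rho point_tens -compA lunitiK compm1 comp1m.
by rewrite -surjective_pairing eprojK.
Qed.

Definition Fmui (X Y : C) := sval (mui_spec X Y).

Lemma FmuK X Y : Fmui X Y ∘ Fmu X Y = idm _.
Proof. by rewrite /Fmui; case: mui_spec => m []. Qed.

Lemma FmuiK X Y : Fmu X Y ∘ Fmui X Y = idm _.
Proof. by rewrite /Fmui; case: mui_spec => m []. Qed.

Lemma Fmui_rho X Y (z : eob E (X ⊗ Y)) : Fmui X Y ∘ rho (point z)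
  = (rho (point (eproj z).1) ⊠ rho (point (eproj z).2)) ∘ luniti unitob.
Proof.
have -> : rho (point z) = Fmu X Y ∘
    ((rho (point (eproj z).1) ⊠ rho (point (eproj z).2)) ∘ luniti unitob).
  by rewrite compA Fmu_rho point_tens -compA lunitiK compm1 -surjective_pairing eprojK.
by rewrite compA FmuK comp1m.
Qed.

(** The object [FO X ⊗ FO Y] is isomorphic to [FO (X ⊗ Y)], which reduces three
factors to two. *)
Lemma rho_tens3_epi (X Y Z : C) W (h k : hom ((FO X ⊗ FO Y) ⊗ FO Z) W) :
  (forall p q r, h ∘ ((rho p ⊠ rho q) ⊠ rho r) = k ∘ ((rho p ⊠ rho q) ⊠ rho r)) ->
  h = k.
Proof.
move=> hk; rewrite -[h]compm1 -[k]compm1.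
have -> : idm ((FO X ⊗ FO Y) ⊗ FO Z)
    = (Fmui X Y ⊠ idm (FO Z)) ∘ (Fmu X Y ⊠ idm (FO Z)).
  by rewrite -tens_comp FmuK comp1m tens1.
rewrite !compA; congr (_ ∘ _).
apply: (coproduct_joint_epi (@rho_tens_coproduct (X ⊗ Y) Z)) => z.
by rewrite -!compA -tens_comp Fmui_rho comp1m tens_compl !compA hk.
Qed.

Lemma rho_unit_iso : rho (idm unitob) ∘ del (FO unitob) = idm _.
Proof.
apply: (coproduct_joint_epi (@rho_coproduct unitob)) => x.
rewrite -compA (unit_terminal (del _ ∘ _) (idm _)) compm1 comp1m.
by congr rho; exact: unit_terminal.
Qed.

Lemma rho_lunit_epi (X : C) W (h k : hom (unitob ⊗ FO X) W) :
  (forall p : hom unitob X, h ∘ (idm unitob ⊠ rho p) = k ∘ (idm unitob ⊠ rho p)) ->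
  h = k.
Proof.
move=> hk; apply: (coproduct_joint_epi (det_coproduct_tensl (A := unitob)
  distD (eob_small E X) (@iotaP X))) => x.
by rewrite -rho_point.
Qed.

Lemma rho_runit_epi (X : C) W (h k : hom (FO X ⊗ unitob) W) :
  (forall p : hom unitob X, h ∘ (rho p ⊠ idm unitob) = k ∘ (rho p ⊠ idm unitob)) ->
  h = k.
Proof.
move=> hk; apply: (coproduct_joint_epi (det_coproduct_tensr (A := unitob)
  distD (eob_small E X) (@iotaP X))) => x.
by rewrite -rho_point.
Qed.

Definition free_symmon_functor : symmon_functor C D.
Proof.
refine (@SymMonFunctor C D free_functor Fmu Fmui (rho (idm unitob)) (del (FO unitob))
  FmuK FmuiK _ rho_unit_iso _ _ _ _ _).
- exact: unit_terminal.
- move=> X X' Y Y' f g; apply: rho_tens_epi => p q.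
  rewrite -!compA -tens_comp /= !Fmap_rho !Fmu_rho compA Fmap_rho.
  by rewrite tens_comp -!compA.
- move=> X Y Z /=; apply: rho_tens3_epi => p q r.
  have -> : Fmap (assoc X Y Z) ∘ Fmu (X ⊗ Y) Z ∘ (Fmu X Y ⊠ idm (FO Z))
        ∘ ((rho p ⊠ rho q) ⊠ rho r)
      = rho (assoc X Y Z ∘ (((p ⊠ q) ∘ luniti unitob) ⊠ r ∘ luniti unitob))
        ∘ (lunit unitob ∘ (lunit unitob ⊠ idm unitob)).
    rewrite -2!compA -tens_comp Fmu_rho comp1m tens_compl (compA (Fmu _ _)) Fmu_rho.
    by rewrite !compA Fmap_rho !compA.
  have -> : Fmu X (Y ⊗ Z) ∘ (idm (FO X) ⊠ Fmu Y Z) ∘ assoc (FO X) (FO Y) (FO Z)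
        ∘ ((rho p ⊠ rho q) ⊠ rho r)
      = rho ((p ⊠ ((q ⊠ r) ∘ luniti unitob)) ∘ luniti unitob)
        ∘ (lunit unitob ∘ (idm unitob ⊠ lunit unitob) ∘ assoc _ _ _).
    rewrite -compA assoc_nat compA -(compA (Fmu _ _)) -tens_comp Fmu_rho comp1m.
    by rewrite tens_compr (compA (Fmu _ _)) Fmu_rho !compA.
  congr (_ ∘ _); last exact: unit_terminal.
  congr rho; rewrite tens_compl tens_compr -!compA (compA (assoc _ _ _)) assoc_nat.
  by rewrite -compA; congr (_ ∘ _); exact: unit3_terminal.
- move=> X /=; apply: rho_lunit_epi => p.
  rewrite -!compA -tens_comp comp1m compm1 Fmu_rho compA Fmap_rho lunit_nat.
  by rewrite compA lunit_nat -compA lunitiK compm1.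
- move=> X /=; apply: rho_runit_epi => p.
  rewrite -!compA -tens_comp comp1m compm1 Fmu_rho compA Fmap_rho runit_nat.
  rewrite (unit_terminal (lunit _) (runit _)); congr (_ ∘ _); congr rho.
  by rewrite compA runit_nat -compA (unit_terminal (_ ∘ _) (idm _)) compm1.
- move=> X Y /=; apply: rho_tens_epi => p q.
  rewrite -!compA Fmu_rho compA Fmap_rho swap_nat (compA (Fmu _ _)) Fmu_rho -[RHS]compA.
  congr (_ ∘ _); last exact: unit_terminal.
  by congr rho; rewrite compA swap_nat -compA; congr (_ ∘ _); exact: unit2_terminal.
Defined.

Definition free_markov_functor : markov_functor C D.
Proof.
refine (@MarkovFunctor C D free_symmon_functor _) => X /=.
rewrite -[RHS]comp1m -FmuK -compA; congr (_ ∘ _).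
apply: (coproduct_joint_epi (@rho_coproduct X)) => x.
have dr : deterministic (rho (point x)) by rewrite rho_point; exact: proj2_sig.
rewrite Fmap_rho (point_det x) -compA dr compA Fmu_rho -compA.
rewrite (unit_terminal (_ ∘ _) (idm _)) compm1; congr rho; congr (_ ∘ _).
exact: unit2_terminal.
Defined.

(** An arbitrary coproduct of [C] is isomorphic to a disjoint union, on whose
vertex each point comes from exactly one summand. *)
Lemma free_functor_coproducts : preserves_coproducts small free_markov_functor.
Proof.
move=> J X S inj sJ cop.
have [T [inj' [sigma bij]]] := bijective_cocone_exists E (X : J -> detcat C) sJ.
have [phi [phi' [pK Kp phiP _]]] :=
  coproduct_unique (bijective_cocone_coproduct bij) cop.
have copT : is_coproduct (fun j => Fmap (sval (inj' j))).
  case: (bij) => _ [tau sigmaK tauK]; apply: is_coproductP => Y.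
    move=> f; have [h hP] := coproduct_copair
      (fun t : eob E T => f (tag (tau t)) ∘ rho (point (tagged (tau t)))) (@rho_coproduct T).
    exists h => j; apply: (coproduct_joint_epi (@rho_coproduct (X j))) => x.
    by rewrite -compA Fmap_rho (point_cocone x bij) hP sigmaK.
  move=> h k hk; apply: (coproduct_joint_epi (@rho_coproduct T)) => t.
  rewrite -(tauK t) -(point_cocone _ bij) -Fmap_rho !compA.
  by rewrite hk.
have iphi : is_iso (fmap free_markov_functor phi).
  exists (fmap free_markov_functor phi'); rewrite -!fmap_comp.
  by rewrite pK Kp !fmap1.
have := coproduct_iso iphi (fun j => is_iso_id _) copT.
congr is_coproduct; apply: functional_extensionality_dep => j.
by rewrite compm1 -phiP fmap_comp.
Qed.

End Existence.

Lemma markov_functor_exists :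
  exists F : markov_functor C D, preserves_coproducts small F.
Proof.
have cops (X : C) : exists (S : D) (inj : eob E X -> hom (unitob : detcat D) S),
    is_coproduct inj.
  by case: distD => /(_ (eob E X) (fun=> unitob) (eob_small E X)).
have [FO FOP] := dep_choice cops; have [iota iotaP] := dep_choice FOP.
have frees (X : C) : exists rho : hom unitob X -> hom unitob (FO X),
    midpoint_hom (embedding_coinflip E unitob X) (d unitob (FO X)) rho /\
    forall x, rho (point x) = sval (iota X x).
  have [rho] := point_free_exists (fun x => sval (iota X x)) (@itD unitob (FO X)).
  by exists rho.
have [rho rhoP] := dep_choice frees.
exists (free_markov_functor iotaP (fun X => (rhoP X).1) (fun X => (rhoP X).2)).
exact: free_functor_coproducts.
Qed.
End Initiality.

Theorem kleisli_embedding_initial (R : realType) (small : smallset -> Prop)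
    (C : markov) : small bool -> kleisli_embedding R small C ->
  initial_dist_iter_coinflip small C.
Proof.
move=> sb E; split; first exact: embedding_dist_iter_coinflip E.
move=> D [distD [d itD]]; split; first exact: (markov_functor_exists E sb distD itD).
by move=> F G; exact: (comparison_unique E sb distD itD).
Qed.

(** * The categories of small sets, finite sets and all sets *)

Section Instances.
Local Open Scope classical_set_scope.
Local Open Scope card_scope.

Variable R : realType.

Definition SetDelta_embedding : kleisli_embedding R small_all (SetDelta R).
Proof.
refine (@KleisliEmbedding R small_all (SetDelta R) (fun X => X) (fun X Y f => f)
  _ _ _ _ tt _ (fun X Y z => z) (fun X Y z => z) _ _ _ _ _ _) => //.
- by move=> X Y f g.
- by move=> X Y k; exists k.
- by case.
- move=> J X _; exists {j : J & X j}, id, id; split=> z; exact: erefl.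
Defined.

Variables (K : smallset) (regK : infinite_regular K).

Definition SetDelta_lt_embedding :
  kleisli_embedding R (small_lt K) (SetDelta_lt R regK).
Proof.
refine (@KleisliEmbedding R (small_lt K) (SetDelta_lt R regK) (fun X => sval X)
  (fun X Y f => f) _ _ _ _ tt _ (fun X Y z => z) (fun X Y z => z) _ _ _ _ _ _) => //.
- by move=> X Y f g.
- by move=> X Y k; exists k.
- by case.
- by move=> X; exact: (proj2_sig X).
- move=> J X sJ; have sS := regK.2 J (fun j => sval (X j)) sJ (fun j => proj2_sig (X j)).
  exists (exist _ {j : J & sval (X j)} sS), id, id; split=> z; exact: erefl.
Defined.

Lemma card_lt_bool : card_lt bool K.
Proof.
case: regK => infK _; split; last first.
  apply/negP => e; apply: infK; have [n en] : finite_set [set: bool] by [].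
  by exists n; rewrite -(card_eql e).
have /infiniteP natK := infK.
apply: card_le_trans natK.
have : $|{injfun [set: bool] >-> [set: nat]}|.
  by apply/injfunPex; exists nat_of_bool => // -[] [].
by move=> [f]; exact: inj_card_le f.
Qed.

End Instances.

Section FinStoch.
Local Open Scope ring_scope.
Variable R : realType.

Lemma esum_finType (X : finType) (a : X -> R) : (forall x, 0 <= a x) ->
  (\esum_(x in [set: {classic X}]) (a x)%:E = (\sum_x a x)%:E)%E.
Proof.
move=> a0; rewrite (@reindex_esum R X {classic X} setT setT id)//; last first.
  by split=> // x _; exists x.
rewrite esum_fset; [|exact: finite_finset|by move=> x _; rewrite lee_fin].
rewrite (_ : [set: X]%classic = [set` enum X]%classic); last first.
  by apply/seteqP; split=> x //= _; rewrite mem_enum.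
by rewrite -fsbig_seq ?enum_uniq// big_enum sumEFin.
Qed.

Definition dist_of_row (X Y : FinStoch R) (f : hom X Y) (x : X) : dist R Y.
Proof.
refine (@Dist R Y (stmx f x) (stmx_ge0 f x) _).
by rewrite esum_finType ?stmx_sum1//; exact: stmx_ge0.
Defined.

Lemma dbind_finType (X Y : finType) (p : dist R X) (f : X -> dist R Y) y :
  dbind p f y = \sum_x p x * f x y.
Proof.
by apply: EFin_inj; rewrite dbindE esum_finType// => x; rewrite mulr_ge0// pmf_ge0.
Qed.

Lemma finite_enum (J : smallset) : finite_set [set: J] ->
  exists s : seq {classic J}, forall j, j \in s.
Proof.
move=> /(@finite_seqP {classic J})[s sE]; exists s => j.
by have : [set: {classic J}]%classic j by []; rewrite sE.
Qed.

Definition FinStoch_embedding : kleisli_embedding R small_finite (FinStoch R).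
Proof.
refine (@KleisliEmbedding R small_finite (FinStoch R) (fun X => X) dist_of_row
  _ _ _ _ tt _ (fun X Y z => z) (fun X Y z => z) _ _ _ _ _ _) => //.
- move=> X Y f g fg; apply: stochastic_ext => x y.
  exact: (congr1 (fun k : kernel R X Y => k x y) fg).
- move=> X Y k; have k1 (x : X) : \sum_y k x y = 1.
    by apply: EFin_inj; rewrite -esum_finType ?pmf_sum1//; exact: pmf_ge0.
  exists (@Stochastic R X Y (fun x y => k x y) (fun x y => pmf_ge0 (k x) y) k1).
  by apply: kernel_ext.
- by move=> X; apply: kernel_ext => x y /=; case: eqP => [->|xy];
    [rewrite asboolT|rewrite asboolF].
- by move=> X Y Z g f; apply: kernel_ext => x z; rewrite /kcomp dbind_finType.
- by case.
- by move=> X; apply: kernel_ext => x y /=; case: eqP => [->|xy];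
    [rewrite asboolT|rewrite asboolF].
- by move=> X; rewrite /small_finite; exact: finite_finset.
- move=> J X /finite_enum[s sP].
  (* The index set is replaced by the finite type of entries of an enumeration. *)
  pose S : FinStoch R := {j : seq_sub s & X (val j)} : finType.
  exists S, (fun z : {j : J & X j} => existT (fun j : seq_sub s => X (val j) : Type)
     (SeqSub (sP (tag z))) (tagged z)),
   (fun z : S => existT (fun j => X j : Type) (val (tag z)) (tagged z)).
  split; first by case.
  by move=> [[j js] x]; rewrite (bool_irrelevance (sP j) js).
Defined.

End FinStoch.

Theorem theorem1p2 (R : realType) :
  (forall (K : smallset) (regK : infinite_regular K),
     initial_dist_iter_coinflip (small_lt K) (SetDelta_lt R regK)) /\
  initial_dist_iter_coinflip small_finite (FinStoch R) /\
  initial_dist_iter_coinflip small_all (SetDelta R).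
Proof.
split; [|split].
- move=> K regK.
  exact: (kleisli_embedding_initial (card_lt_bool regK) (SetDelta_lt_embedding R regK)).
- have fin_bool : small_finite bool by exact: finite_finset.
  exact: (kleisli_embedding_initial fin_bool (FinStoch_embedding R)).
- exact: (kleisli_embedding_initial I (SetDelta_embedding R)).
Qed.
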